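(* Let $G$ be a finite group, $p$ a prime and $(\mathbb{K},R,\mathbb{F})$ a splitting $p$-modular system for $G$. Then in the Green ring for $RG$, the virtual projective module $P_{1,p,G}$ satisfies $$P_{1,p,G}=\sum_{Q/G}\mathrm{Ind}_{N_G(Q)}^{G}\left(P\left[\mathrm{St}_p(N_G(Q)/Q)\right]\right),$$ where $Q/G$ denotes a set of representatives for the $G$-conjugacy classes of $p$-subgroups $Q$ of $G$ such that $Q=O_p(N_G(Q))$.
   Context: A splitting $p$-modular system $(\mathbb{K},R,\mathbb{F})$ for $G$ consists of a complete discrete valuation ring $R$ with field of fractions $\mathbb{K}$ of characteristic $0$ and residue field $\mathbb{F}$ of characteristic $p$, such that $\mathbb{K}$ and $\mathbb{F}$ are splitting fields for $G$. An element of $G$ is $p$-regular if its order is prime to $p$ and $p$-singular otherwise; a $p$-element is an element whose order is a power of $p$ (including the identity). $\Psi_{1,p,G}$ is the class function of $G$ which is $0$ on all $p$-singular elements and whose value at a $p$-regular $y\in G$ is the number of $p$-elements of $C_G(y)$. It is a generalized character of $G$ vanishing on $p$-singular elements. $P_{1,p,G}$ denotes the unique virtual projective module (i.e. $\mathbb{Z}$-linear combination of projective $RG$-modules) in the Green ring of $RG$ affording the virtual character $\Psi_{1,p,G}$. The Green ring of $RG$ is that of isomorphism classes of finitely generated $R$-free $RG$-modules with respect to direct sums. For a finite group $X$, let $\mathcal{S}_p(X)$ be the set of all chains $\sigma = (Q_1<Q_2<\dots<Q_n)$ of non-trivial $p$-subgroups of $X$ (strictly increasing), including the empty chain; $|\sigma|=n$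 is the number of subgroups in $\sigma$ and $X_\sigma$ is the stabilizer of $\sigma$ in $X$ under conjugation (so the empty chain has $|\sigma|=0$ and stabilizer $X$). The Steinberg virtual module of $X$ is $$\mathrm{St}_p(X)=\sum_{\sigma\in\mathcal{S}_p(X)/X}(-1)^{|\sigma|}\mathrm{Ind}_{X_\sigma}^{X}(R)$$ in the Green ring of $RX$, where $R$ denotes the trivial module and the sum is over representatives of the $X$-orbits of chains. It is known (Webb) that $\mathrm{St}_p(X)$ is a virtual projective $RX$-module. If $M=A-B$ is a virtual projective $R[N_G(Q)/Q]$-module (with $A,B$ projective), $P[M]$ denotes the virtual projective $RN_G(Q)$-module $P(A)-P(B)$, where $P(A)$ is the projective cover, as $RN_G(Q)$-module, of the inflation of $A$ to $N_G(Q)$, and likewise for $B$; this is well defined. $O_p(X)$ is the largest normal $p$-subgroup of $X$. *)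

(* Defs.v *)
From HB Require Import structures.
From mathcomp Require Import all_boot all_order all_algebra all_fingroup.
From mathcomp Require Import all_solvable all_field all_character.

Set Implicit Arguments.
Unset Strict Implicit.
Unset Printing Implicit Defensive.

Import GroupScope GRing.Theory.
Local Open Scope ring_scope.

Section ModularSystem.

Definition uniformizer (R : idomainType) (pi : R) : Prop :=
  [/\ pi != 0, pi \isn't a GRing.unit
    & forall x : R, x != 0 ->
        exists u : R, exists n : nat, u \is a GRing.unit /\ x = u * pi ^+ n].

Definition adically_close (R : idomainType) (pi : R) (N : nat) (x y : R) : Prop :=
  exists c : R, x - y = c * pi ^+ N.

Definition adically_complete (R : idomainType) (pi : R) : Prop :=
  forall u : nat -> R,
    (forall N, exists M, forall i j, (M <= i)%N -> (M <= j)%N ->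
       adically_close pi N (u i) (u j)) ->
    exists l : R, forall N, exists M, forall i, (M <= i)%N ->
       adically_close pi N (u i) l.

Definition complete_dvr (R : idomainType) : Prop :=
  exists2 pi : R, uniformizer pi & adically_complete pi.

(* [iota] exhibits K as the field of fractions of R, and [red] exhibits F as  *)
(* the quotient of R by its maximal ideal, the set of non-units.              *)
Record splitting_modular_system (p : nat) (gT : finGroupType) (G : {group gT})
    (K : fieldType) (R : idomainType) (F : fieldType)
    (iota : {rmorphism R -> K}) (red : {rmorphism R -> F}) : Prop :=
  SplittingModularSystem {
    sms_complete_dvr : complete_dvr R;
    sms_iota_inj : injective iota;
    sms_fractions : forall x : K,
      exists a b : R, b != 0 /\ x = iota a / iota b;
    sms_charK : [pchar K] =i pred0;
    sms_red_surj : forall y : F, exists x : R, red x = y;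
    sms_red_ker : forall x : R, (red x == 0) = (x \isn't a GRing.unit);
    sms_charF : p \in [pchar F];
    sms_splitK : group_splitting_field K G;
    sms_splitF : group_splitting_field F G
  }.

End ModularSystem.

(* A finitely generated R-free RG-module is R^n with a matrix representation  *)
(* of G acting, as everywhere in the library, on the right of row vectors.    *)
Record lattice (R : comUnitRingType) (gT : finGroupType) (G : {group gT}) :=
  Lattice { ldim : nat; lrepr :> mx_representation R G ldim }.

Section Lattices.

Variables (R : comUnitRingType) (gT : finGroupType) (G : {group gT}).

Definition lattice_hom (M N : lattice R G) (f : 'M[R]_(ldim M, ldim N)) : Prop :=
  forall x, x \in G -> M x *m f = f *m N x.

Definition lattice_iso (M N : lattice R G) : Prop :=
  exists (f : 'M[R]_(ldim M, ldim N)) (g : 'M[R]_(ldim N, ldim M)),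
    [/\ lattice_hom f, f *m g = 1%:M & g *m f = 1%:M].

Lemma zero_lattice_subproof : mx_repr G (fun _ : gT => 1%:M : 'M[R]_0).
Proof. by split=> // x y _ _; rewrite mulmx1. Qed.

Definition zero_lattice : lattice R G :=
  Lattice (MxRepresentation zero_lattice_subproof).

Lemma trivial_lattice_subproof : mx_repr G (fun _ : gT => 1%:M : 'M[R]_1).
Proof. by split=> // x y _ _; rewrite mulmx1. Qed.

Definition trivial_lattice : lattice R G :=
  Lattice (MxRepresentation trivial_lattice_subproof).

Lemma dsum_lattice_subproof (M N : lattice R G) :
  mx_repr G (fun x => block_mx (M x) 0 0 (N x)).
Proof.
split=> [|x y Gx Gy]; first by rewrite !repr_mx1 -scalar_mx_block.
by rewrite mulmx_block !(mulmx0, mul0mx, addr0, add0r, repr_mxM).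
Qed.

Definition dsum_lattice (M N : lattice R G) : lattice R G :=
  Lattice (MxRepresentation (dsum_lattice_subproof M N)).

Definition free_lattice (n : nat) : lattice R G :=
  iter n (dsum_lattice (Lattice (regular_repr R G))) zero_lattice.

Definition projective (P : lattice R G) : Prop :=
  exists (n : nat) (L : lattice R G),
    lattice_iso (dsum_lattice P L) (free_lattice n).

Definition submodule (M : lattice R G) (U : 'rV[R]_(ldim M) -> Prop) : Prop :=
  [/\ U 0,
      forall u v, U u -> U v -> U (u + v),
      forall a u, U u -> U (a *: u)
    & forall x u, x \in G -> U u -> U (u *m M x)].

Definition projective_cover (P M : lattice R G) : Prop :=
  projective P /\
  exists f : 'M[R]_(ldim P, ldim M),
    [/\ lattice_hom f,
        forall w : 'rV_(ldim M), exists v : 'rV_(ldim P), v *m f = w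
      & forall U : 'rV_(ldim P) -> Prop, submodule U ->
          (forall v, exists2 u, U u & (v - u) *m f = 0) -> forall v, U v].

(* The additive group of the Green ring is the Grothendieck group of lattices *)
(* under direct sum: the pair (A, B) stands for the formal difference A - B,  *)
(* and [green_eq] is equality of the corresponding elements.                  *)
Definition virtual : Type := (lattice R G * lattice R G)%type.

Definition green_eq (V W : virtual) : Prop :=
  exists L : lattice R G,
    lattice_iso (dsum_lattice (dsum_lattice V.1 W.2) L)
                (dsum_lattice (dsum_lattice W.1 V.2) L).

Definition green_zero : virtual := (zero_lattice, zero_lattice).

Definition green_add (V W : virtual) : virtual :=
  (dsum_lattice V.1 W.1, dsum_lattice V.2 W.2).

(* (-1)^n V *)
Definition green_sign (n : nat) (V : virtual) : virtual :=
  if odd n then (V.2, V.1) else V.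

Definition green_class (M : lattice R G) : virtual := (M, zero_lattice).

Definition virtual_projective (V : virtual) : Prop :=
  exists A B : lattice R G, [/\ projective A, projective B & green_eq V (A, B)].

Definition affords (K : fieldType) (iota : {rmorphism R -> K}) (V : virtual)
    (chi : gT -> K) : Prop :=
  forall x, x \in G -> iota (\tr (V.1 x)) - iota (\tr (V.2 x)) = chi x.

End Lattices.

Arguments zero_lattice {R gT G}.
Arguments green_zero {R gT G}.
Arguments trivial_lattice R {gT} G.

Section Induction.

Variables (R : comUnitRingType) (gT : finGroupType) (H G : {group gT}).

Definition coset_rep (i : 'I_#|rcosets H G|) : gT := repr (enum_val i).

Lemma coset_repP (i : 'I_#|rcosets H G|) : H :* coset_rep i = enum_val i.
Proof.
rewrite /coset_rep; have /rcosetsP[x _ ->] := enum_valP i.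
by apply/rcoset_eqP/mem_repr_rcoset.
Qed.

(* The module M (x)_{RH} RG is the direct sum of the M (x) t_i, where t_i     *)
(* runs over right coset representatives, and x maps m (x) t_i to             *)
(* m (t_i x t_j^-1) (x) t_j for the unique j such that t_i x lies in H t_j.   *)
(* The formula is only meant to be used when H is a subgroup of G.            *)
Definition induced_mx (M : lattice R H) (x : gT) :
    'M[R]_(\sum_(i < #|rcosets H G|) ldim M) :=
  \mxblock_(i < #|rcosets H G|, j < #|rcosets H G|)
    (let h := (coset_rep i * x * (coset_rep j)^-1)%g in
     if h \in H then M h else 0).

Lemma induced_mx_repr (M : lattice R H) : mx_repr G (induced_mx M).
Proof.
have inj (i j : 'I_#|rcosets H G|) :
    (coset_rep i * (coset_rep j)^-1)%g \in H -> i = j.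
  by rewrite -mem_rcoset => /rcoset_eqP; rewrite !coset_repP => /enum_val_inj.
have ex x (i : 'I_#|rcosets H G|) : x \in G ->
    exists j, (coset_rep i * x * (coset_rep j)^-1)%g \in H.
  move=> Gx; have Hix : (H :* (coset_rep i * x))%g \in rcosets H G.
    rewrite rcosetM coset_repP; have /rcosetsP[y Gy ->] := enum_valP i.
    by rewrite -rcosetM mem_rcosets (subsetP (mulg_subr _ _)) ?groupM.
  exists (enum_rank_in Hix (H :* (coset_rep i * x))%g).
  rewrite -mem_rcoset coset_repP enum_rankK_in //.
  exact: rcoset_refl.
split=> [|x y Gx Gy].
  rewrite /induced_mx -mxdiagZ; apply: eq_mxblock => i j /=.
  rewrite mulg1; case: eqVneq => [<-|nij].
    by rewrite mulgV group1 repr_mx1 conform_mx_id.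
  by case: ifP => // /inj eij; rewrite eij eqxx in nij.
rewrite mul_mxblock; apply: eq_mxblock => i k /=.
have [j Hj] := ex x i Gx.
rewrite (bigD1 j) //= big1 ?addr0 => [|j' nj]; last first.
  case: ifP => Hj'; last by rewrite mul0mx.
  suff eqj : j' = j by rewrite eqj eqxx in nj.
  apply: inj; have := groupM (groupVr Hj') Hj.
  by rewrite !invMg invgK !mulgA mulgKV mulgKV.
rewrite Hj; set a := (_ * x * _)%g in Hj *; set b := (coset_rep j * y * _)%g.
have -> : (coset_rep i * (x * y) * (coset_rep k)^-1)%g = (a * b)%g.
  by rewrite /a /b !mulgA mulgKV.
rewrite groupMl //; case: ifP => Hb; last by rewrite mulmx0.
exact: repr_mxM.
Qed.

Definition induced_lattice (M : lattice R H) : lattice R G :=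
  Lattice (MxRepresentation (induced_mx_repr M)).

Definition green_ind (V : virtual R H) : virtual R G :=
  (induced_lattice V.1, induced_lattice V.2).

End Induction.

Section Steinberg.

Variables (R : comUnitRingType) (p : nat) (xT : finGroupType) (X : {group xT}).

(* A strictly increasing sequence Q_1 < ... < Q_n is given by its set of      *)
(* members, which determines it; the empty chain is set0.                     *)
Definition p_chains : {set {set {group xT}}} :=
  [set sigma : {set {group xT}} |
     [forall Q in sigma, [&& Q \subset X, p.-group Q & Q :!=: 1%g]] &&
     [forall Q1 in sigma, forall Q2 in sigma,
        (Q1 \subset Q2) || (Q2 \subset Q1)]].

Definition chain_stabilizer (sigma : {set {group xT}}) : {group xT} :=
  'N_X(sigma | 'JG)%G.

Definition steinberg : virtual R X :=
  \big[@green_add R xT X/green_zero]_(sigma in orbit_transversal 'JG^* X p_chains)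
    green_sign #|sigma|
      (green_class
         (induced_lattice X (trivial_lattice R (chain_stabilizer sigma)))).

End Steinberg.

Arguments steinberg R p {xT} X.

Section Bracket.

Variables (R : comUnitRingType) (gT : finGroupType) (G Q : {group gT}).

Definition inflation (A : lattice R ('N_G(Q) / Q)) : lattice R 'N_G(Q) :=
  Lattice (morphim_repr A (subsetIr G 'N(Q))).

(* V represents P[M]. *)
Definition bracket (M : virtual R ('N_G(Q) / Q)) (V : virtual R 'N_G(Q)) : Prop :=
  exists (A B : lattice R ('N_G(Q) / Q)) (PA PB : lattice R 'N_G(Q)),
    [/\ projective A /\ projective B,
        green_eq M (A, B),
        projective_cover PA (inflation A),
        projective_cover PB (inflation B)
      & green_eq V (PA, PB)].

End Bracket.

Section PsiOne.

Variables (p : nat) (gT : finGroupType) (G : {group gT}).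

Definition Psi1 (y : gT) : nat :=
  if p^'.-elt y then #|[set x in 'C_G[y] | p.-elt x]| else 0%N.

(* P represents the virtual projective module P_{1,p,G}. *)
Definition is_P1 (K : fieldType) (R : comUnitRingType)
    (iota : {rmorphism R -> K}) (P : virtual R G) : Prop :=
  virtual_projective P /\ affords iota P (fun y => (Psi1 y)%:R).

Definition radical_subgroups : {set {group gT}} :=
  [set Q : {group gT} |
     [&& Q \subset G, p.-group Q & Q :==: 'O_p('N_G(Q))%g]].

End PsiOne.

(* Main.v *)
(* Two virtual projective modules with the same character are equal: if       *)
(* 1 = sum_g g^-1 t g on a projective lattice P (Higman), then for a simple   *)
(* FG-module S the dimension of Hom(S, P/pi) equals, modulo p,                *)
(* sum_g tr S(g^-1) tr(t g), which depends only on the character of P.  If    *)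
(* the characters of P and P' agree, one strips off common projective         *)
(* indecomposable summands until all these dimensions vanish modulo p; then   *)
(* P = p P1 and P' = p P1', and one descends.                                 *)
(*                                                                            *)
(* It remains to compare characters.  Projective characters vanish on         *)
(* p-singular elements, and at a p-regular y in N_G(Q) the projective cover   *)
(* of the inflation of A has character |C_Q(y)| chi_A(yQ), as its restriction *)
(* to Q<y> is induced from the restriction of A to <y>.  The character of     *)
(* St_p(N_G(Q)/Q) at yQ is the Euler characteristic e(Q) of the y-stable      *)
(* chains in N_G(Q)/Q; it vanishes if Q is not radical, and can be computed   *)
(* from all chains of y-stable p-subgroups above Q, so that the sum of        *)
(* e(Q') over the y-stable p-subgroups Q' containing Q is 1.  Taking Q = <x>  *)
(* for each p-element x of C_G(y) gives Psi_1(y) = sum_Q |C_Q(y)| e(Q).       *)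

Require Import Defs.
From Stdlib Require Import Setoid Morphisms Classical.
From HB Require Import structures.
From mathcomp Require Import all_boot all_order all_algebra all_fingroup.
From mathcomp Require Import all_solvable all_field all_character.
From mathcomp Require Import ring.

Set Implicit Arguments.
Unset Strict Implicit.
Unset Printing Implicit Defensive.

Import GroupScope GRing.Theory.
Local Open Scope ring_scope.

(** * The Green ring *)

(** A virtual projective module is determined by its character, so the identity becomes an equality
    of class functions. With the two sides written as differences A1 - B1 and A2 - B2 of
    projectives, it is enough that A1 + B2 and A2 + B1 are isomorphic, and
    [projective_character_iso] deduces this from equal traces. Projectivity is handled in Higman's
    form [hprojective].

    For that theorem, a simple S inside the reduction of a projective P yields a projective U whose
    reduction has S as its only minimal submodule ([projective_indecomposable]), and U splits off
    every projective whose reduction contains S ([essential_summand]). If P and P' share such an S,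
    cancel U and induct. If not, the dimensions of Hom(S, P/pi) and Hom(S, P'/pi), equal modulo p by
    [hom_trace_char], vanish modulo p; then P and P' are p-fold multiples ([divide_by_p]), and the
    induction goes on with the p-th parts.

    As for traces, both sides vanish at p-singular elements ([hprojective_singular0]). For p-regular
    y let e(Q) be the [euler] number of the y-stable p-subgroups P of G with Q < P <= N_G(Q). The
    Steinberg module of N_G(Q)/Q has trace e(Q) at yQ ([vtrace_steinberg], [euler_quotient]), the
    projective cover multiplies it by |C_Q(y)| ([mxtrace_projective_cover]), and induction turns the
    sum over classes into a sum over all radical Q normalised by y ([vtrace_induced_orbit]). What
    remains is Psi_1(y) = sum_Q |C_Q(y)| e(Q), which is [Psi1_euler]. Since e(Q) = 0 for non-radical
    Q ([euler_above_norm0]), Q may run over all y-stable p-subgroups; and e(Q) may be computed from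
    all y-stable p-subgroups above Q ([euler_above_norm]), so the e(P) with P >= Q add up to 1.
    Taking Q = <x> and summing over the p-elements x of C_G(y) gives the formula. *)

Section GreenRing.

Variables (R : comUnitRingType) (gT : finGroupType) (G : {group gT}).
Implicit Types (M N L : lattice R G) (V W X : virtual R G).

Lemma lattice_iso_refl M : lattice_iso M M.
Proof.
by exists 1%:M, 1%:M; split; rewrite ?mulmx1 // => x _; rewrite mulmx1 mul1mx.
Qed.

#[local] Hint Resolve lattice_iso_refl : core.

Lemma lattice_hom_inv M N (f : 'M_(ldim M, ldim N)) (g : 'M_(ldim N, ldim M)) :
  lattice_hom f -> f *m g = 1%:M -> g *m f = 1%:M -> lattice_hom g.
Proof.
move=> hf fg gf x Gx.
by rewrite -[LHS]mul1mx -gf -!mulmxA (mulmxA f) -hf // -(mulmxA (M x)) fg mulmx1.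
Qed.

Lemma lattice_iso_sym M N : lattice_iso M N -> lattice_iso N M.
Proof.
by case=> f [g [hf fg gf]]; exists g, f; split=> //; apply: lattice_hom_inv gf.
Qed.

Lemma lattice_iso_trans M N L :
  lattice_iso M N -> lattice_iso N L -> lattice_iso M L.
Proof.
case=> f [g [hf fg gf]] [f' [g' [hf' fg' gf']]].
exists (f *m f'), (g' *m g); split.
- by move=> x Gx; rewrite mulmxA hf // -mulmxA hf' // mulmxA.
- by rewrite -mulmxA (mulmxA f') fg' mul1mx.
- by rewrite -mulmxA (mulmxA g) gf mul1mx.
Qed.

#[export] Instance lattice_iso_equiv : Equivalence (@lattice_iso R gT G).
Proof.
split; [exact: lattice_iso_refl | exact: lattice_iso_sym |].
exact: lattice_iso_trans.
Qed.

#[export] Instance dsum_lattice_proper :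
  Proper (@lattice_iso R gT G ==> @lattice_iso R gT G ==> @lattice_iso R gT G)
    (@dsum_lattice R gT G).
Proof.
move=> M M' [f [g [hf fg gf]]] N N' [f' [g' [hf' fg' gf']]].
exists (block_mx f 0 0 f'), (block_mx g 0 0 g'); split.
- move=> x Gx; rewrite !mulmx_block !(mul0mx, mulmx0, addr0, add0r).
  by rewrite hf ?hf'.
- by rewrite mulmx_block !(mul0mx, mulmx0, addr0, add0r) fg fg' -scalar_mx_block.
- by rewrite mulmx_block !(mul0mx, mulmx0, addr0, add0r) gf gf' -scalar_mx_block.
Qed.

Lemma dsum_latticeC M N : lattice_iso (dsum_lattice M N) (dsum_lattice N M).
Proof.
exists (block_mx 0 1%:M 1%:M 0), (block_mx 0 1%:M 1%:M 0); split.
- move=> x Gx; rewrite !mulmx_block.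
  by rewrite !(mul0mx, mulmx0, addr0, add0r, mulmx1, mul1mx).
- by rewrite mulmx_block !(mul0mx, mulmx0, addr0, add0r, mulmx1) -scalar_mx_block.
- by rewrite mulmx_block !(mul0mx, mulmx0, addr0, add0r, mulmx1) -scalar_mx_block.
Qed.

Lemma lattice_iso_cast M N (e : ldim M = ldim N) :
  (forall x, x \in G -> castmx (e, e) (M x) = N x) -> lattice_iso M N.
Proof.
case: M N e => m M [n N] /= e; case: _ / e N => N eMN.
exists 1%:M, 1%:M; split; rewrite ?mulmx1 //.
by move=> x /eMN; rewrite castmx_id /= mulmx1 mul1mx.
Qed.

Lemma dsum_latticeA M N L :
  lattice_iso (dsum_lattice M (dsum_lattice N L))
              (dsum_lattice (dsum_lattice M N) L).
Proof.
pose e := addnA (ldim M) (ldim N) (ldim L).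
apply: (@lattice_iso_cast (dsum_lattice M (dsum_lattice N L))
          (dsum_lattice (dsum_lattice M N) L) e) => x _ /=.
have /= := block_mxAx (M x) 0 0 0 (N x) 0 0 0 (L x).
rewrite !row_mx0 !col_mx0 => ->.
by rewrite castmx_comp castmx_id.
Qed.

Lemma dsum_lattice0 M : lattice_iso (dsum_lattice M zero_lattice) M.
Proof.
exists (col_mx 1%:M 0), (row_mx 1%:M 0); split.
- move=> x Gx /=; rewrite mul_block_col mul_col_mx.
  by rewrite !(mulmx0, mul0mx, mulmx1, mul1mx, addr0).
- rewrite mul_col_row !(mulmx0, mul0mx, mulmx1) [RHS]scalar_mx_block.
  by congr block_mx; apply/matrixP=> [[]].
- by rewrite mul_row_col mulmx1 mul0mx addr0.
Qed.

Lemma dsum_latticeACA (A B C D : lattice R G) :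
  lattice_iso (dsum_lattice (dsum_lattice A B) (dsum_lattice C D))
              (dsum_lattice (dsum_lattice A C) (dsum_lattice B D)).
Proof.
rewrite -2!dsum_latticeA (dsum_latticeA B) (dsum_latticeC B C).
by rewrite -(dsum_latticeA C).
Qed.

Lemma dsum_lattice_of M N (X : lattice R G)
    (i1 : 'M_(ldim M, ldim X)) (i2 : 'M_(ldim N, ldim X))
    (p1 : 'M_(ldim X, ldim M)) (p2 : 'M_(ldim X, ldim N)) :
    lattice_hom i1 -> lattice_hom i2 ->
    i1 *m p1 = 1%:M -> i2 *m p2 = 1%:M -> i1 *m p2 = 0 -> i2 *m p1 = 0 ->
    p1 *m i1 + p2 *m i2 = 1%:M ->
  lattice_iso X (dsum_lattice M N).
Proof.
move=> h1 h2 e11 e22 e12 e21 e; apply: lattice_iso_sym.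
exists (col_mx i1 i2), (row_mx p1 p2); split.
- move=> x Gx; rewrite mul_block_col mul_col_mx !mul0mx addr0 add0r.
  by rewrite h1 ?h2.
- by rewrite mul_col_row e11 e22 e12 e21 -scalar_mx_block.
- by rewrite mul_row_col.
Qed.

Lemma mxtrace_iso M N x : lattice_iso M N -> x \in G -> \tr (M x) = \tr (N x).
Proof.
case=> f [g [hf fg gf]] Gx.
by rewrite -[M x]mulmx1 -fg mulmxA hf // mxtrace_mulC mulmxA gf mul1mx.
Qed.

Lemma green_eq_refl V : green_eq V V.
Proof. by exists zero_lattice. Qed.

Lemma green_eq_sym V W : green_eq V W -> green_eq W V.
Proof. by case=> L iso; exists L; apply: lattice_iso_sym. Qed.

Lemma green_eq_trans V W X : green_eq V W -> green_eq W X -> green_eq V X.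
Proof.
case=> L VW [L' WX].
(* The two isomorphisms are added, so W.1 + W.2 joins L and L' in the stabilising lattice; [mix]
   only regroups summands. *)
exists (dsum_lattice (dsum_lattice W.1 W.2) (dsum_lattice L L')).
have mix (A B C D E F : lattice R G) :
    lattice_iso (dsum_lattice (dsum_lattice A B)
                   (dsum_lattice (dsum_lattice C D) (dsum_lattice E F)))
                (dsum_lattice (dsum_lattice (dsum_lattice A D) E)
                   (dsum_lattice (dsum_lattice C B) F)).
  rewrite (dsum_latticeC C D) dsum_latticeA (dsum_latticeACA A B D C).
  by rewrite (dsum_latticeC B C) dsum_latticeACA.
rewrite mix VW WX dsum_latticeC -mix.
by rewrite (dsum_latticeC L' L).
Qed.

Lemma green_add_proper V V' W W' :
  green_eq V V' -> green_eq W W' -> green_eq (green_add V W) (green_add V' W').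
Proof.
case=> L VV' [L' WW']; exists (dsum_lattice L L') => /=.
rewrite (dsum_latticeACA V.1) (dsum_latticeACA _ _ L) VV' WW'.
by rewrite (dsum_latticeACA V'.1) (dsum_latticeACA _ _ L).
Qed.

Lemma green_eq_trace V W x : green_eq V W -> x \in G ->
  \tr (V.1 x) - \tr (V.2 x) = \tr (W.1 x) - \tr (W.2 x).
Proof.
case=> L /mxtrace_iso/[apply]; rewrite !mxtrace_block => /addIr e.
by apply/eqP; rewrite subr_eq addrAC eq_sym subr_eq e.
Qed.

End GreenRing.

#[export] Hint Resolve lattice_iso_refl : core.

(** * Functoriality of induction *)

Section InductionFunctor.

Variables (R : comUnitRingType) (gT : finGroupType) (H G : {group gT}).
Implicit Types M N : lattice R H.

Definition induced_hom m n (f : 'M[R]_(m, n)) :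
    'M_(\sum_(i < #|rcosets H G|) m, \sum_(i < #|rcosets H G|) n) :=
  \mxblock_(i, j) (if i == j then f else 0).

Lemma induced_homM m n q (f : 'M[R]_(m, n)) (g : 'M[R]_(n, q)) :
  induced_hom f *m induced_hom g = induced_hom (f *m g).
Proof.
rewrite mul_mxblock; apply: eq_mxblock => i k.
rewrite (bigD1 i) //= eqxx big1 ?addr0 => [|j /negPf nij].
  by case: ifP => _ //; rewrite mulmx0.
by rewrite [i == j]eq_sym nij mul0mx.
Qed.

Lemma induced_hom1 m : induced_hom (1%:M : 'M[R]_m) = 1%:M.
Proof.
rewrite -mxdiagZ; apply: eq_mxblock => i j.
by rewrite conform_mx_id.
Qed.

Lemma induced_homD m n (f g : 'M[R]_(m, n)) :
  induced_hom f + induced_hom g = induced_hom (f + g).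
Proof.
by rewrite -mxblockD; apply: eq_mxblock => i j; case: ifP; rewrite ?addr0.
Qed.

Lemma induced_hom0 m n : induced_hom (0 : 'M[R]_(m, n)) = 0.
Proof. by rewrite -mxblock0; apply: eq_mxblock => i j; case: ifP. Qed.

Lemma induced_homP M N (f : 'M_(ldim M, ldim N)) :
  lattice_hom f ->
  @lattice_hom R gT G (induced_lattice G M) (induced_lattice G N) (induced_hom f).
Proof.
move=> hf x Gx; rewrite !mul_mxblock; apply: eq_mxblock => i k.
rewrite (bigD1 k) //= eqxx big1 ?addr0 => [|j /negPf njk]; last first.
  by rewrite njk mulmx0.
rewrite (bigD1 i) //= eqxx big1 ?addr0 => [|j /negPf njk]; last first.
  by rewrite eq_sym njk mul0mx.
by case: ifP => [/hf//|_]; rewrite mul0mx mulmx0.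
Qed.

Lemma induced_iso M N :
  lattice_iso M N -> lattice_iso (induced_lattice G M) (induced_lattice G N).
Proof.
case=> f [g [/induced_homP hf fg gf]].
exists (induced_hom f), (induced_hom g); split=> //.
  by rewrite induced_homM fg induced_hom1.
by rewrite induced_homM gf induced_hom1.
Qed.

Lemma induced_dsum M N :
  lattice_iso (induced_lattice G (dsum_lattice M N))
              (dsum_lattice (induced_lattice G M) (induced_lattice G N)).
Proof.
apply: (@dsum_lattice_of _ _ _ (induced_lattice G M) (induced_lattice G N)
          (induced_lattice G (dsum_lattice M N))
          (induced_hom (row_mx 1%:M 0 : 'M_(ldim M, ldim (dsum_lattice M N))))
          (induced_hom (row_mx 0 1%:M : 'M_(ldim N, ldim (dsum_lattice M N))))
          (induced_hom (col_mx 1%:M 0 : 'M_(ldim (dsum_lattice M N), ldim M)))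
          (induced_hom (col_mx 0 1%:M : 'M_(ldim (dsum_lattice M N), ldim N)))).
- apply: induced_homP => x Hx /=.
  by rewrite mul_row_block mul_mx_row !(mulmx0, mul0mx, mulmx1, mul1mx, addr0).
- apply: induced_homP => x Hx /=.
  by rewrite mul_row_block mul_mx_row !(mulmx0, mul0mx, mulmx1, mul1mx, add0r).
- by rewrite induced_homM mul_row_col mulmx1 mulmx0 addr0 induced_hom1.
- by rewrite induced_homM mul_row_col mulmx1 mulmx0 add0r induced_hom1.
- by rewrite induced_homM mul_row_col mulmx1 mulmx0 addr0 induced_hom0.
- by rewrite induced_homM mul_row_col mulmx1 mulmx0 addr0 induced_hom0.
rewrite !induced_homM induced_homD !mul_col_row add_block_mx.
rewrite !(mulmx0, mul0mx, mulmx1, addr0, add0r) -scalar_mx_block.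
by rewrite induced_hom1.
Qed.

Lemma green_ind_proper (V W : virtual R H) :
  green_eq V W -> green_eq (green_ind G V) (green_ind G W).
Proof.
case=> L /induced_iso iso; exists (induced_lattice G L).
by move: iso; rewrite /= !induced_dsum.
Qed.

End InductionFunctor.

(** * Matrices over a complete discrete valuation ring *)

Section LocalRing.

Variables (R : idomainType) (F : fieldType) (red : {rmorphism R -> F}).
Hypothesis red_surj : forall y : F, exists x : R, red x = y.
Hypothesis red_ker : forall x : R, (red x == 0) = (x \isn't a GRing.unit).

Lemma unitmx_red n (A : 'M[R]_n) : (A \in unitmx) = (map_mx red A \in unitmx).
Proof. by rewrite !unitmxE det_map_mx [RHS]unitfE red_ker negbK. Qed.

Lemma lift_mx m n (B : 'M[F]_(m, n)) : exists A : 'M[R]_(m, n), map_mx red A = B.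
Proof.
have /fin_all_exists[f fP] : forall ij : 'I_m * 'I_n, exists x, red x = B ij.1 ij.2.
  by move=> ij; apply: red_surj.
by exists (\matrix_(i, j) f (i, j)); apply/matrixP=> i j; rewrite !mxE fP.
Qed.

Lemma row_free_red_inv m n (A : 'M[R]_(m, n)) :
  row_free (map_mx red A) -> exists C, A *m C = 1%:M.
Proof.
move=> fA; have [C eC] := lift_mx (pinvmx (map_mx red A)).
have uAC : A *m C \in unitmx by rewrite unitmx_red map_mxM eC mulmxVp // unitmx1.
by exists (C *m invmx (A *m C)); rewrite mulmxA mulmxV.
Qed.

(** The matrix 1 - d reduces to the identity, hence is invertible, and d kills it. *)
Lemma idem_red0 n (d : 'M[R]_n) : d *m d = d -> map_mx red d = 0 -> d = 0.
Proof.
move=> dd d0; have u : 1%:M - d \in unitmx.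
  by rewrite unitmx_red map_mxB d0 subr0 map_mx1 unitmx1.
by rewrite -[d]mulmx1 -(mulmxV u) mulmxA mulmxBr mulmx1 dd subrr mul0mx.
Qed.

(** The image of an idempotent over a local ring is free. The rank factorisation of the reduction is
    lifted; [c] reduces to 1 and corrects the lifts so that b a = 1, and then e - a b is an
    idempotent with zero reduction. *)
Lemma split_idem n (e : 'M[R]_n) : e *m e = e ->
  exists r (a : 'M[R]_(n, r)) (b : 'M[R]_(r, n)),
    [/\ a *m b = e, b *m a = 1%:M & r = \rank (map_mx red e)].
Proof.
move=> ee; set e' := map_mx red e; exists (\rank e').
have ee' : e' *m e' = e' by rewrite -map_mxM ee.
have [a0 ea0] := lift_mx (col_base e'); have [b0 eb0] := lift_mx (row_base e').
have ba' : row_base e' *m col_base e' = 1%:M.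
  apply: (row_full_inj (col_base_full e')); apply: (row_free_inj (row_base_free e')).
  by rewrite /= mulmx1 mulmx_base mulmxA mulmx_base -mulmxA mulmx_base.
have rowe : row_base e' *m e' = row_base e'.
  by have := mulmxA (row_base e') (col_base e') (row_base e');
    rewrite mulmx_base ba' mul1mx.
have ecol : e' *m col_base e' = col_base e'.
  by have := mulmxA (col_base e') (row_base e') (col_base e');
    rewrite mulmx_base ba' mulmx1.
pose c := b0 *m e *m (e *m a0).
have ec : map_mx red c = 1%:M.
  by rewrite !map_mxM ea0 eb0 -/e' rowe ecol ba'.
have uc : c \in unitmx by rewrite unitmx_red ec unitmx1.
pose a := e *m a0; pose b := invmx c *m (b0 *m e).
have ba : b *m a = 1%:M by rewrite /a /b -mulmxA mulVmx.
exists a, b; split=> //.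
have ea : e *m a = a by rewrite /a mulmxA ee.
have be : b *m e = b by rewrite /b -!mulmxA ee.
apply/esym/eqP; rewrite -subr_eq0; apply/eqP/idem_red0.
  rewrite mulmxBl !mulmxBr ee mulmxA ea -(mulmxA a b e) be.
  rewrite (mulmxA (a *m b)) -(mulmxA a b a).
  by rewrite ba mulmx1 subrr subr0.
have eci : map_mx red (invmx c) = 1%:M.
  by rewrite -[LHS]mulmx1 -ec -map_mxM mulVmx // map_mx1.
rewrite map_mxB map_mxM /a /b !map_mxM eci mul1mx ea0 eb0 -/e'.
by rewrite rowe ecol mulmx_base subrr.
Qed.

Variable pi : R.
Hypothesis piU : uniformizer pi.
Hypothesis piC : adically_complete pi.

Lemma red_pi : red pi = 0.
Proof. by have [_ nu _] := piU; apply/eqP; rewrite red_ker. Qed.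

Lemma red0_pi x : red x = 0 -> exists c, x = c * pi.
Proof.
move/eqP; rewrite red_ker => nx; have [-> | x0] := eqVneq x 0.
  by exists 0; rewrite mul0r.
have [_ _ /(_ x x0)[u [[|n] [uu ex]]]] := piU.
  by rewrite ex mulr1 uu in nx.
by exists (u * pi ^+ n); rewrite -mulrA -exprSr.
Qed.

Lemma pi_adic_separated x : (forall N, exists c, x = c * pi ^+ N) -> x = 0.
Proof.
move=> small; apply/eqP/negPn/negP=> x0.
have [p0 np /(_ x x0)[u [n [uu ex]]]] := piU.
have [c ec] := small n.+1; case/negP: np.
have /(mulIf (expf_neq0 n p0)) eu : u * pi ^+ n = c * pi * pi ^+ n.
  by rewrite -ex ec exprS mulrA.
by move: uu; rewrite eu unitrM => /andP[].
Qed.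

Definition pi_adic_small N m n (A : 'M[R]_(m, n)) := exists C, A = pi ^+ N *: C.

Lemma smallD N m n (A B : 'M[R]_(m, n)) :
  pi_adic_small N A -> pi_adic_small N B -> pi_adic_small N (A + B).
Proof. by case=> [C ->] [D ->]; exists (C + D); rewrite scalerDr. Qed.

Lemma smallN N m n (A : 'M[R]_(m, n)) :
  pi_adic_small N A -> pi_adic_small N (- A).
Proof. by case=> [C ->]; exists (- C); rewrite scalerN. Qed.

Lemma smallM N m n q (A : 'M[R]_(m, n)) (B : 'M[R]_(n, q)) :
  pi_adic_small N A \/ pi_adic_small N B -> pi_adic_small N (A *m B).
Proof.
by case=> [[C ->]|[C ->]]; [exists (C *m B); rewrite scalemxAl
                    |exists (A *m C); rewrite scalemxAr].
Qed.

Lemma smallW N M m n (A : 'M[R]_(m, n)) :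
  (N <= M)%N -> pi_adic_small M A -> pi_adic_small N A.
Proof.
by move=> /subnKC <- [C ->]; exists (pi ^+ (M - N) *: C); rewrite exprD scalerA.
Qed.

Lemma small_eq0 m n (A : 'M[R]_(m, n)) : (forall N, pi_adic_small N A) -> A = 0.
Proof.
move=> sA; apply/matrixP=> i j; rewrite mxE; apply: pi_adic_separated => N.
by have [C ->] := sA N; exists (C i j); rewrite mxE mulrC.
Qed.

Lemma small_mxP N m n (A : 'M[R]_(m, n)) :
  (forall i j, exists c, A i j = c * pi ^+ N) -> pi_adic_small N A.
Proof.
move=> sA; have /fin_all_exists[f fP] :
    forall ij : 'I_m * 'I_n, exists c, A ij.1 ij.2 = c * pi ^+ N by move=> ij.
exists (\matrix_(i, j) f (i, j)); apply/matrixP=> i j.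
by rewrite !mxE mulrC -fP.
Qed.

Definition newton_step n (e : 'M[R]_n) : 'M[R]_n :=
  e + (e * e - e) * (1 - e *+ 2).

(** An identity between polynomials in one variable, checked in R[X] and evaluated at e. The square
    of e^2 - e on the right makes the iteration converge. *)
Lemma newton_step_defect n (e : 'M[R]_n) :
  newton_step e * newton_step e - newton_step e =
    (e * e - e) * (e * e - e) * (e * e *+ 4 - e *+ 4 - 1 *+ 3).
Proof.
case: n e => [|n] e; first by apply/matrixP=> [[]].
pose X : {poly R} := 'X.
pose s : {poly R} := X + (X * X - X) * (1 - X *+ 2).
have id : s * s - s = (X * X - X) * (X * X - X) * (X * X *+ 4 - X *+ 4 - 1 *+ 3).
  by rewrite /s; ring.
have /= := congr1 (horner_mx e) id.
by rewrite !(rmorphM, rmorphB, rmorphD, rmorphMn, rmorph1) /= horner_mx_X.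
Qed.

(* Newton iteration [e <- 3 e^2 - 2 e^3] converges pi-adically. *)
Lemma lift_idem n (b : 'M[R]_n) : map_mx red (b *m b) = map_mx red b ->
  exists e : 'M[R]_n, [/\ e *m e = e, map_mx red e = map_mx red b
    & forall x, x *m b = b *m x -> x *m e = e *m x].
Proof.
move=> bb; pose e_ k := iter k (@newton_step n) b.
have defect k : pi_adic_small k.+1 (e_ k *m e_ k - e_ k).
  elim: k => [|k IHk].
    apply: small_mxP => i j; apply: red0_pi.
    by have /matrixP/(_ i j) := bb; rewrite !mxE rmorphB => ->; rewrite subrr.
  have /= -> := newton_step_defect (e_ k).
  have [C eC] := IHk; apply: smallM; left.
  have {}eC : e_ k * e_ k - e_ k = pi ^+ k.+1 *: C by [].
  rewrite eC; exists (pi ^+ k *: (C *m C)).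
  rewrite -[_ * _]/(_ *m _) -scalemxAl -scalemxAr !scalerA -!exprD.
  by rewrite addSnnS addnC.
have step i k : pi_adic_small k.+1 (e_ (k + i)%N - e_ k).
  elim: i => [|i IHi]; first by exists 0; rewrite addn0 subrr scaler0.
  rewrite addnS -[e_ _](subrK (e_ (k + i)%N)) -addrA; apply: smallD => //.
  rewrite /= /newton_step [X in X - _]addrC addrK; apply: smallM; left.
  by apply: smallW (defect (k + i)%N); rewrite ltnS leq_addr.
have close k i j : (k <= i)%N -> (k <= j)%N -> pi_adic_small k (e_ i - e_ j).
  move=> ki kj; have -> : e_ i - e_ j = (e_ i - e_ k) - (e_ j - e_ k).
    by rewrite opprB addrA subrK.
  rewrite -(subnKC ki) -(subnKC kj).
  by apply: smallD; [|apply: smallN]; apply: smallW (step _ _).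
have /fin_all_exists[l lP] : forall ij : 'I_n * 'I_n, exists l, forall N, exists M,
    forall i, (M <= i)%N -> adically_close pi N (e_ i ij.1 ij.2) l.
  move=> [i j]; apply: piC => N; exists N => a a' Na Na'.
  have [C /matrixP/(_ i j)] := close N a a' Na Na'.
  by rewrite !mxE => eC; exists (C i j); rewrite /= eC mulrC.
pose L := \matrix_(i, j) l (i, j).
have lim N : pi_adic_small N (e_ N - L).
  apply: small_mxP => i j; have [M /= MP] := lP (i, j) N.
  have [c ec] := MP (maxn M N) (leq_maxl _ _).
  have [C /matrixP/(_ i j)] := close N N (maxn M N) (leqnn _) (leq_maxr _ _).
  rewrite !mxE => eC; exists (C i j + c).
  by rewrite mulrDl [_ * pi ^+ N]mulrC -eC -ec addrA subrK.
clearbody L; exists L; split.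
- apply/eqP; rewrite -subr_eq0; apply/eqP/small_eq0 => N.
  have -> : L *m L - L = (e_ N *m e_ N - e_ N) - (e_ N *m (e_ N - L))
                         - (e_ N - L) *m L + (e_ N - L).
    rewrite mulmxBr mulmxBl.
    move: (L *m L) (e_ N *m L) (e_ N *m e_ N) (e_ N) => A B C E.
    apply/matrixP=> i j; rewrite !mxE; ring.
  apply: smallD; last exact: lim.
  apply: smallD; last by apply: smallN; apply: smallM; left; apply: lim.
  apply: smallD; last by apply: smallN; apply: smallM; right; apply: lim.
  by apply: smallW (defect N).
- have -> : map_mx red b = map_mx red (e_ 1%N).
    rewrite /e_ /= /newton_step map_mxD map_mxM map_mxB.
    by rewrite [map_mx red (b * b)]bb subrr mul0mx addr0.
  apply/eqP; rewrite eq_sym -subr_eq0 -map_mxB; have [C ->] := lim 1%N.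
  by rewrite map_mxZ expr1 red_pi scale0r.
move=> x xb; have xe k : x *m e_ k = e_ k *m x.
  elim: k => // k IHk; rewrite /= /newton_step.
  have : GRing.comm x (e_ k) by [].
  move=> c; apply: commrD => //; apply: commrM.
    by apply: commrB => //; apply: commrM.
  by apply: commrB; [apply: commr1 | apply: commrMn].
apply/eqP; rewrite -subr_eq0; apply/eqP/small_eq0 => N.
have -> : x *m L - L *m x = (e_ N - L) *m x - x *m (e_ N - L).
  rewrite mulmxBr mulmxBl xe.
  move: (_ *m x) (L *m x) (x *m L) => A B C.
  by apply/matrixP=> i j; rewrite !mxE; ring.
by apply: smallD; [|apply: smallN]; apply: smallM; [left | right]; apply: lim.
Qed.

End LocalRing.

(** * Higman's criterion *)

Section RelativeTrace.

Variables (R : comUnitRingType) (gT : finGroupType) (G : {group gT}).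

(** The relative trace from linear maps to RG-homomorphisms. *)
Definition rel_trace m n (rM : mx_representation R G m)
    (rN : mx_representation R G n) (X : 'M[R]_(m, n)) : 'M[R]_(m, n) :=
  \sum_(x in G) rM x^-1%g *m X *m rN x.

Variables (l m n : nat).
Variables (rL : mx_representation R G l) (rM : mx_representation R G m).
Variables (rN : mx_representation R G n).

Lemma rel_trace_hom X x :
  x \in G -> rM x *m rel_trace rM rN X = rel_trace rM rN X *m rN x.
Proof.
move=> Gx; rewrite mulmx_sumr mulmx_suml.
rewrite (reindex_inj (mulIg x)) /=; apply: eq_big => y; first by rewrite groupMr.
rewrite groupMr // => Gy; rewrite invMg !repr_mxM ?groupV //.
by rewrite !mulmxA -repr_mxM ?groupV // mulgV repr_mx1 mul1mx.
Qed.

Lemma mul_rel_trace f X : (forall x, x \in G -> rL x *m f = f *m rM x) ->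
  f *m rel_trace rM rN X = rel_trace rL rN (f *m X).
Proof.
move=> hf; rewrite mulmx_sumr; apply: eq_bigr => x Gx.
by rewrite !mulmxA hf ?groupV.
Qed.

Lemma rel_trace_mul f X : (forall x, x \in G -> rM x *m f = f *m rN x) ->
  rel_trace rL rM X *m f = rel_trace rL rN (X *m f).
Proof.
move=> hf; rewrite mulmx_suml; apply: eq_bigr => x Gx.
by rewrite -!mulmxA hf.
Qed.

End RelativeTrace.

Lemma map_rel_trace (R R' : comUnitRingType) (f : {rmorphism R -> R'})
    (gT : finGroupType) (G : {group gT}) m n (rM : mx_representation R G m)
    (rN : mx_representation R G n) X :
  map_mx f (rel_trace rM rN X) =
    rel_trace (map_repr f rM) (map_repr f rN) (map_mx f X).
Proof.
by rewrite (raddf_sum (map_mx f)); apply: eq_bigr => x Gx; rewrite /= !map_mxM.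
Qed.

(* By Higman's criterion this is equivalent to projectivity; unlike a         *)
(* complement in a free module, the witness is easy to carry through          *)
(* induction, restriction and direct summands.                                *)
Definition hprojective (R : comUnitRingType) (gT : finGroupType)
    (G : {group gT}) (P : lattice R G) :=
  exists t, rel_trace P P t = 1%:M.

Section Higman.

Variables (R : comUnitRingType) (gT : finGroupType) (G : {group gT}).
Implicit Types P M N : lattice R G.

Lemma hprojective_retract P M (f : 'M_(ldim P, ldim M)) (g : 'M_(ldim M, ldim P)) :
  lattice_hom f -> lattice_hom g -> f *m g = 1%:M ->
  hprojective M -> hprojective P.
Proof.
move=> hf hg fg [t et]; exists (f *m t *m g).
by rewrite -(rel_trace_mul _ _ hg) -(mul_rel_trace _ _ hf) et mulmx1.
Qed.

Lemma hprojective_iso M N : lattice_iso M N -> hprojective M -> hprojective N.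
Proof.
case=> f [g [hf fg gf]].
exact: hprojective_retract (lattice_hom_inv hf fg gf) hf gf.
Qed.

Lemma hprojective_dsum M N :
  hprojective M -> hprojective N -> hprojective (dsum_lattice M N).
Proof.
case=> t et [u eu]; exists (block_mx t 0 0 u).
pose i1 : 'M[R]_(ldim M, ldim (dsum_lattice M N)) := row_mx 1%:M 0.
pose p1 : 'M[R]_(ldim (dsum_lattice M N), ldim M) := col_mx 1%:M 0.
pose i2 : 'M[R]_(ldim N, ldim (dsum_lattice M N)) := row_mx 0 1%:M.
pose p2 : 'M[R]_(ldim (dsum_lattice M N), ldim N) := col_mx 0 1%:M.
have rw := (mul_row_block, mul_mx_row, mul_block_col, mul_col_mx, mulmx0,
  mul0mx, mulmx1, mul1mx, addr0, add0r).
have hi1 : lattice_hom i1 by move=> x Gx; rewrite /= !rw.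
have hp1 : lattice_hom p1 by move=> x Gx; rewrite /= !rw.
have hi2 : lattice_hom i2 by move=> x Gx; rewrite /= !rw.
have hp2 : lattice_hom p2 by move=> x Gx; rewrite /= !rw.
have -> : block_mx t 0 0 u = p1 *m t *m i1 + p2 *m u *m i2.
  rewrite /p1 /p2 /i1 /i2 (mul_col_mx _ _ t) (mul_col_mx _ _ u).
  rewrite !mul1mx !mul0mx !mul_col_row add_block_mx.
  by rewrite !(mulmx0, mul0mx, mulmx1, addr0, add0r).
have -> (X Y : 'M_(ldim (dsum_lattice M N))) :
    rel_trace (dsum_lattice M N) (dsum_lattice M N) (X + Y) =
    rel_trace (dsum_lattice M N) (dsum_lattice M N) X +
    rel_trace (dsum_lattice M N) (dsum_lattice M N) Y.
  by rewrite -big_split; apply: eq_bigr => x _; rewrite mulmxDr mulmxDl.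
rewrite -!(rel_trace_mul _ _ hi1) -!(rel_trace_mul _ _ hi2).
rewrite -(mul_rel_trace _ _ hp1) -(mul_rel_trace _ _ hp2) et eu.
rewrite /p1 /p2 /i1 /i2 !mulmx1 !mul_col_row add_block_mx.
by rewrite !(mulmx0, mul0mx, mulmx1, addr0, add0r) -scalar_mx_block.
Qed.

Lemma hprojective_zero : hprojective (@zero_lattice R gT G).
Proof. by exists 0; apply/matrixP=> [[]]. Qed.

Lemma hprojective_regular : hprojective (Lattice (regular_repr R G)).
Proof.
(* The projection onto the coordinate of the identity; its conjugates are the projections onto all
   coordinates. *)
exists (delta_mx (gring_index G 1) (gring_index G 1)).
apply/row_matrixP=> i; rewrite /rel_trace linear_sum /=.
have rowt x : x \in G -> row i (regular_repr R G x^-1%g *m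
    delta_mx (gring_index G 1) (gring_index G 1) *m regular_repr R G x) =
    if enum_val i == x then row i 1%:M else 0.
  move=> Gx; rewrite !row_mul rowK mul_delta_mx_cond.
  have -> : (gring_index G (enum_val i * x^-1) == gring_index G 1) = (enum_val i == x).
    rewrite -(inj_eq (can_inj (@gring_valK _ G))) !gring_indexK //.
      by rewrite -eq_mulgV1.
    by rewrite groupM ?groupV ?enum_valP.
  case: eqP => [ex|]; rewrite ?mul0mx // -rowE rowK gring_indexK //.
  by rewrite mul1g -ex gring_valK row1.
rewrite (bigD1 (enum_val i)) ?enum_valP //= rowt ?enum_valP // eqxx.
rewrite big1 ?addr0 // => x /andP[Gx nxi].
by rewrite rowt // eq_sym (negPf nxi).
Qed.

Lemma projective_hprojective P : projective P -> hprojective P.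
Proof.
case=> n [L iso]; have: hprojective (dsum_lattice P L).
  apply: hprojective_iso (lattice_iso_sym iso) _.
  elim: {iso}n => [|n IHn]; first exact: hprojective_zero.
  by apply: hprojective_dsum => //; apply: hprojective_regular.
apply: (@hprojective_retract P (dsum_lattice P L)
  (row_mx 1%:M 0 : 'M_(ldim P, ldim (dsum_lattice P L)))
  (col_mx 1%:M 0 : 'M_(ldim (dsum_lattice P L), ldim P))).
- move=> x Gx /=; rewrite mul_row_block mul_mx_row.
  by rewrite !(mulmx0, mul0mx, mulmx1, mul1mx, addr0).
- move=> x Gx /=; rewrite mul_block_col mul_col_mx.
  by rewrite !(mulmx0, mul0mx, mulmx1, mul1mx, addr0).
by rewrite mul_row_col mulmx1 mul0mx addr0.
Qed.

(** The linear lift f s, averaged against t, becomes equivariant while its composite with g stays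
    f. *)
Lemma hprojective_lift P (M N : lattice R G) (f : 'M_(ldim P, ldim N))
    (g : 'M_(ldim M, ldim N)) s :
    hprojective P -> lattice_hom f -> lattice_hom g -> s *m g = 1%:M ->
  exists2 h : 'M_(ldim P, ldim M), lattice_hom h & h *m g = f.
Proof.
case=> t et hf hg sg; exists (rel_trace P M (t *m f *m s)).
  by move=> x Gx; apply: rel_trace_hom.
rewrite (rel_trace_mul _ _ hg) -!mulmxA sg mulmx1.
by rewrite -(rel_trace_mul _ _ hf) et mul1mx.
Qed.

Lemma hprojective_unit P : #|G|%:R \is a @GRing.unit R -> hprojective P.
Proof.
move=> uG; exists (#|G|%:R^-1)%:M.
rewrite /rel_trace (eq_bigr (fun _ => (#|G|%:R^-1)%:M)).
  by rewrite sumr_const -scaler_nat scale_scalar_mx mulrV.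
move=> x Gx; rewrite -mulmxA -scalar_mxC mulmxA -repr_mxM ?groupV //.
by rewrite mulVg repr_mx1 mul1mx.
Qed.

End Higman.

(** * Projectivity under restriction and induction *)

Section Subgroups.

Variables (R : comUnitRingType) (gT : finGroupType) (H G : {group gT}).
Hypothesis sHG : H \subset G.

Definition res_lattice (P : lattice R G) : lattice R H :=
  Lattice (subg_repr P sHG).

Lemma hprojective_res P : hprojective P -> hprojective (res_lattice P).
Proof.
case=> t et.
(* Each element of G is c x with c a left coset representative and x in H; this regroups the trace
   of t over G as a trace over H. *)
exists (\sum_(C in lcosets H G) P (repr C)^-1%g *m t *m P (repr C)).
have lcosets_repr C : C \in lcosets H G -> repr C \in G /\ (repr C *: H)%g = C.
  case/lcosetsP=> c Gc ->.
  have rc := mem_repr c (lcoset_refl H c); split; last exact/lcoset_eqP.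
  by have /lcosetP[h Hh ->] := rc; rewrite groupM // (subsetP sHG).
rewrite -et /rel_trace.
rewrite [RHS](partition_big (fun g => (g *: H)%g) (mem (lcosets H G))) /=.
  rewrite (eq_bigr (fun x => \sum_(C in lcosets H G)
      P (repr C * x)^-1%g *m t *m P (repr C * x)%g)).
    rewrite exchange_big; apply: eq_bigr => C /lcosets_repr[GrC cC].
    rewrite [RHS](reindex_inj (mulgI (repr C))) /=.
    apply: eq_bigl => h; rewrite groupMl // lcosetM -{2}cC (inj_eq (@lcoset_inj _ _)).
    apply/idP/andP=> [Hh | [Gh /eqP eH]]; last by rewrite -eH lcoset_refl.
    by rewrite (subsetP sHG) // lcoset_id.
  move=> x Hx; rewrite mulmx_sumr mulmx_suml; apply: eq_bigr => C.
  case/lcosets_repr=> GrC _; have Gx := subsetP sHG x Hx.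
  by rewrite invMg !repr_mxM ?groupV // !mulmxA.
by move=> g Gg; apply/lcosetsP; exists g.
Qed.

End Subgroups.

Section HigmanInduction.

Variables (R : comUnitRingType) (gT : finGroupType) (H G : {group gT}).
Hypothesis sHG : H \subset G.

Lemma coset_rep_in (i : 'I_#|rcosets H G|) : coset_rep i \in G.
Proof.
rewrite /coset_rep; have /rcosetsP[c Gc ->] := enum_valP i.
case: repr_rcosetP => h Hh; by rewrite groupM // (subsetP sHG).
Qed.

Lemma coset_rep_inj (i j : 'I_#|rcosets H G|) :
  (coset_rep i * (coset_rep j)^-1)%g \in H -> i = j.
Proof.
by rewrite -mem_rcoset => /rcoset_eqP; rewrite !coset_repP => /enum_val_inj.
Qed.

Lemma coset_rep_ex x : x \in G ->
  exists j : 'I_#|rcosets H G|, (x * (coset_rep j)^-1)%g \in H.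
Proof.
move=> Gx; have Hx : (H :* x)%g \in rcosets H G by apply/rcosetsP; exists x.
exists (enum_rank_in Hx (H :* x)%g).
by rewrite -mem_rcoset coset_repP enum_rankK_in // rcoset_refl.
Qed.

Lemma hprojective_induced (M : lattice R H) :
  hprojective M -> hprojective (induced_lattice G M).
Proof.
case=> t et; have [i0 _] := coset_rep_ex (group1 G).
pose r (i : 'I_#|rcosets H G|) := coset_rep i.
(* The witness t is placed in the diagonal block of one coset [i0]; the translates by G spread it
   over all diagonal blocks. *)
exists (\mxblock_(i, j) (if (i == i0) && (j == i0) then t else 0)).
rewrite /rel_trace -mxdiagZ.
rewrite (eq_bigr (fun x => \mxblock_(i, j)
   (if (r i * x^-1 * (r i0)^-1 \in H)%g && (r i0 * x * (r j)^-1 \in H)%g then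
    M (r i * x^-1 * (r i0)^-1)%g *m t *m M (r i0 * x * (r j)^-1)%g else 0))).
  rewrite -mxblock_sum; apply: eq_mxblock => i j /=.
  case: eqVneq => [<-|nij].
    rewrite conform_mx_id -et /rel_trace [RHS]big_mkcond /=.
    rewrite [RHS](reindex (fun x => r i0 * x * (r i)^-1))%g /=; last first.
      exists (fun h => (r i0)^-1 * h * r i)%g => x _ /=.
        by rewrite !mulgA mulVg mul1g mulgKV.
      by rewrite !mulgA mulgV mul1g mulgK.
    rewrite big_mkcond /=; apply: eq_bigr => x _.
    have -> : (r i * x^-1 * (r i0)^-1 = (r i0 * x * (r i)^-1)^-1)%g.
      by rewrite !invMg invgK mulgA.
    rewrite groupV andbb; case: ifP => Gx; case: ifP => // Hx.
    have := subsetP sHG _ Hx.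
    by rewrite groupMr ?groupV ?coset_rep_in // groupMl ?coset_rep_in // Gx.
  apply: big1 => x Gx; case: ifP => // /andP[H1 H2].
  case/eqP: nij; apply: coset_rep_inj; have := groupM H1 H2.
  by rewrite !mulgA mulgKV mulgKV.
move=> x Gx; rewrite !mul_mxblock; apply: eq_mxblock => i j /=.
rewrite (bigD1 i0) //= [X in _ + X]big1 ?addr0 => [|k /negPf nk]; last first.
  rewrite big1 ?mul0mx // => k' _; by rewrite nk andbF mulmx0.
rewrite (bigD1 i0) //= [X in _ + X]big1 ?addr0 => [|k /negPf nk]; last first.
  by rewrite nk mulmx0.
rewrite eqxx /= -/(r i) -/(r j) -/(r i0).
by case: ifP => _; case: ifP => _ //=; rewrite ?mul0mx ?mulmx0.
Qed.

End HigmanInduction.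

(** * Projective lattices are determined by their characters *)

Section Summands.

Variables (R : idomainType) (F : fieldType) (red : {rmorphism R -> F}).
Hypothesis red_surj : forall y : F, exists x : R, red x = y.
Hypothesis red_ker : forall x : R, (red x == 0) = (x \isn't a GRing.unit).
Variables (gT : finGroupType) (G : {group gT}).
Implicit Types P U : lattice R G.

Lemma idem_summand P (e : 'M_(ldim P)) : e *m e = e -> lattice_hom e ->
  exists U (a : 'M_(ldim P, ldim U)) (b : 'M_(ldim U, ldim P)),
    [/\ lattice_hom a, lattice_hom b, a *m b = e, b *m a = 1%:M
      & ldim U = \rank (map_mx red e)].
Proof.
move=> ee he; have [r [a [b [ab ba er]]]] := split_idem red_surj red_ker ee.
have be : b *m e = b by rewrite -ab mulmxA ba mul1mx.
have ea : e *m a = a by rewrite -ab -mulmxA ba mulmx1.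
have Urepr : mx_repr G (fun x => b *m P x *m a).
  split=> [|x y Gx Gy]; first by rewrite repr_mx1 mulmx1.
  have -> : b *m P x *m a *m (b *m P y *m a) = b *m (P x *m (a *m b)) *m P y *m a.
    by rewrite !mulmxA.
  by rewrite ab he // repr_mxM // !mulmxA be.
exists (Lattice (MxRepresentation Urepr)), a, b; split=> // x Gx /=.
  by rewrite !mulmxA ab -he // -mulmxA ea.
by rewrite -[in RHS]be -!mulmxA ab he.
Qed.

Lemma retract_summand P U (f : 'M_(ldim U, ldim P)) (r : 'M_(ldim P, ldim U)) :
    lattice_hom f -> lattice_hom r -> f *m r = 1%:M -> hprojective P ->
  exists2 P2, hprojective P2 & lattice_iso P (dsum_lattice U P2).
Proof.
move=> hf hr fr hP; pose e := 1%:M - r *m f.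
have ee : e *m e = e.
  rewrite mulmxBl mul1mx mulmxBr mulmx1 mulmxA -(mulmxA r f r) fr mulmx1.
  by rewrite subrr subr0.
have he : lattice_hom e.
  by move=> x Gx; rewrite mulmxBl mulmxBr mulmx1 mul1mx !mulmxA hr // -!mulmxA hf.
have [P2 [a [b [ha hb ab ba _]]]] := idem_summand ee he.
exists P2; first exact: hprojective_retract hb ha ba hP.
apply: (dsum_lattice_of hf hb fr ba).
- have -> : a = e *m a by rewrite -ab -mulmxA ba mulmx1.
  by rewrite mulmxA mulmxBr mulmx1 mulmxA fr mul1mx subrr mul0mx.
- have -> : b = b *m e by rewrite -ab mulmxA ba mul1mx.
  by rewrite -mulmxA mulmxBl mul1mx -mulmxA fr mulmx1 subrr mulmx0.
by rewrite ab addrC subrK.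
Qed.

End Summands.

(** * Fitting idempotents *)

Section FittingIdempotent.

Variables (F : fieldType) (n : nat).

(** Equality of ranks splits the space into kernel and image of B, and e projects onto the image.
    From B = X B^2 = B^2 Y one gets e = X B = B Y, which commutes with the centraliser of B. *)
Lemma rank_stable_idem (B : 'M[F]_n) : \rank (B *m B) = \rank B ->
  exists e : 'M[F]_n, [/\ e *m e = e, B *m e = B,
    (exists Y, e = B *m Y) & forall C, C *m B = B *m C -> C *m e = e *m C].
Proof.
move=> rkB; have [X eX] : exists X, B = X *m (B *m B).
  by apply/submxP; rewrite -(mxrank_leqif_sup (submxMl B B)) rkB.
have [Y eY] : exists Y, B = (B *m B) *m Y.
  have /submxP[Z eZ] : (B^T <= (B *m B)^T)%MS.
    have sBB : ((B *m B)^T <= B^T)%MS by rewrite trmx_mul submxMl.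
    by rewrite -(mxrank_leqif_sup sBB) !mxrank_tr rkB.
  by exists Z^T; apply: trmx_inj; rewrite trmx_mul trmxK.
have eXY : X *m B = B *m Y by rewrite {1}eY mulmxA -eX.
exists (B *m Y); split.
- by rewrite -{1}eXY -mulmxA (mulmxA B) mulmxA -eX.
- by rewrite mulmxA -eY.
- by exists Y.
move=> C cCB; rewrite mulmxA cCB -eXY -(mulmxA X) -cCB mulmxA.
rewrite {2}eY !mulmxA -(mulmxA X C) cCB !mulmxA -(mulmxA _ C B) cCB.
by rewrite !mulmxA -(mulmxA X B B) -eX.
Qed.

(** Squaring a preserves the conditions on J and W and lowers the rank until it is stable. *)
Lemma fitting_idem m q (J : 'M[F]_(m, n)) (W : 'M[F]_(q, n)) (a : 'M[F]_n) :
    J *m a = J -> W *m a = 0 ->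
  exists e : 'M[F]_n, [/\ e *m e = e, J *m e = J, W *m e = 0
    & forall C, C *m a = a *m C -> C *m e = e *m C].
Proof.
have [r] := ubnP (\rank a); elim: r a => // r IHr a /ltnSE-ler Ja Wa.
have := mxrankM_maxl a a; rewrite leq_eqVlt => /orP[/eqP rka | ltra].
  have [e [ee ae [Y eY] ce]] := rank_stable_idem rka.
  exists e; split=> //; first by rewrite -{1}Ja -mulmxA ae Ja.
  by rewrite eY mulmxA Wa mul0mx.
have [|||e [ee Je We ce]] := IHr (a *m a).
- exact: leq_trans ltra ler.
- by rewrite mulmxA !Ja.
- by rewrite mulmxA Wa mul0mx.
by exists e; split=> // C cC; apply: ce; rewrite mulmxA cC -mulmxA cC mulmxA.
Qed.

End FittingIdempotent.

(** * Simple submodules of reductions of projective lattices *)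

Section ProjectiveCharacters.

Variables (R : idomainType) (F : fieldType) (red : {rmorphism R -> F}).
Hypothesis red_surj : forall y : F, exists x : R, red x = y.
Hypothesis red_ker : forall x : R, (red x == 0) = (x \isn't a GRing.unit).
Hypothesis complR : complete_dvr R.
Variables (gT : finGroupType) (G : {group gT}).
Implicit Types P U : lattice R G.

Local Notation redr := (map_repr red).

Definition embedding d (S : mx_representation F G d) P (J : 'M_(d, ldim P)) :=
  (forall x, x \in G -> S x *m J = J *m redr P x) /\ J != 0.

(** The reduction of P has simple socle S; this stands in for P being the projective indecomposable
    attached to S. *)
Definition essential d (S : mx_representation F G d) P (J : 'M_(d, ldim P)) :=
  embedding S J /\
  forall W : 'M_(ldim P), mxmodule (redr P) W -> W != 0 -> (J <= W)%MS.

Lemma irr_hom_free d n (S : mx_representation F G d)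
    (N : mx_representation F G n) (J : 'M_(d, n)) :
    mx_irreducible S -> (forall x, x \in G -> S x *m J = J *m N x) -> J != 0 ->
  row_free J.
Proof.
case/mx_irrP=> _ irrS hJ nzJ; rewrite -kermx_eq0; apply: contraR nzJ => nzK.
have : row_full (kermx J).
  apply: irrS nzK; apply/mxmoduleP=> x Gx; apply/sub_kermxP.
  by rewrite -mulmxA hJ // mulmxA mulmx_ker mul0mx.
by case/row_fullP=> D eD; rewrite -[J]mul1mx -{1}eD -mulmxA mulmx_ker mulmx0.
Qed.

(** Induction on the dimension. A nonzero submodule W not containing S gives an endomorphism fixing
    S and killing W; its Fitting idempotent lifts to P and cuts out a smaller summand whose
    reduction still contains S. *)
Lemma projective_indecomposable d (S : mx_representation F G d) P J :
    mx_irreducible S -> hprojective P -> @embedding d S P J ->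
  exists U (J' : 'M_(d, ldim U)), hprojective U /\ essential S J'.
Proof.
move=> irrS; have [n] := ubnP (ldim P); elim: n P J => // n IHn P J.
move=> /ltnSE-len hP [hJ nzJ]; have [[t et] hP'] := (hP, hP).
have [|ess] := classic (essential S J); first by exists P, J.
have [W [modW nzW nJW]] : exists W : 'M_(ldim P),
    [/\ mxmodule (redr P) W, W != 0 & ~ (J <= W)%MS].
  apply: NNPP => noW; case: ess; split=> // W modW nzW.
  by apply/negPn/negP=> nJW; case: noW; exists W; split=> //; apply/negP.
(* As S is simple, J stays injective modulo W, so a linear map j' kills W and retracts J. *)
pose j' := cokermx W *m pinvmx (J *m cokermx W).
have Wj' : W *m j' = 0 by rewrite mulmxA mulmx_coker mul0mx.
have Jj' : J *m j' = 1%:M.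
  rewrite mulmxA mulmxVp // -kermx_eq0; apply/negPn/negP=> nzK; case: nJW.
  have [_ /(_ _ _ nzK) fK] := (mx_irrP S).1 irrS.
  have : row_full (kermx (J *m cokermx W)).
    apply: fK; apply/mxmoduleP=> x Gx; apply/sub_kermxP.
    rewrite mulmxA -(mulmxA _ (S x)) hJ // mulmxA.
    have : (kermx (J *m cokermx W) *m J <= W)%MS.
      by rewrite submxE -mulmxA mulmx_ker.
    move/(submxMr (redr P x))/submx_trans/(_ (mxmoduleP modW x Gx)).
    by rewrite submxE => /eqP.
  case/row_fullP=> D eD.
  have : D *m kermx (J *m cokermx W) *m (J *m cokermx W) = 0.
    by rewrite -mulmxA mulmx_ker mulmx0.
  by rewrite eD mul1mx => Jc; rewrite submxE Jc.
have et' : rel_trace (redr P) (redr P) (map_mx red t) = 1%:M.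
  by rewrite -map_rel_trace et map_mx1.
clearbody j'.
pose a := rel_trace (redr P) (redr P) (j' *m J *m map_mx red t).
have Ja : J *m a = J.
  rewrite (mul_rel_trace _ _ hJ) !mulmxA Jj' mul1mx -(mul_rel_trace _ _ hJ) et'.
  by rewrite mulmx1.
have Wa : W *m a = 0.
  rewrite mulmx_sumr big1 // => x Gx.
  have /submxP[D eD] := mxmoduleP modW _ (groupVr Gx).
  by rewrite !mulmxA eD -(mulmxA D) Wj' mulmx0 !mul0mx.
have [e0 [ee0 Je We ce]] := fitting_idem Ja Wa.
have he0 x : x \in G -> redr P x *m e0 = e0 *m redr P x.
  by move=> Gx; apply: ce; apply: rel_trace_hom.
have [b0 eb0] := lift_mx red_surj e0.
(* Averaging against t makes the lift equivariant and keeps its reduction, because [e0] is already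
   equivariant. *)
pose b := rel_trace P P (b0 *m t).
have eb : map_mx red b = e0.
  by rewrite map_rel_trace map_mxM eb0 -(mul_rel_trace _ _ he0) et' mulmx1.
have [pi piU piC] := complR.
have [|e [ee ebe cbe]] := lift_idem red_ker piU piC (b := b).
  by rewrite map_mxM eb ee0.
have [|U [c [f [hc hf cf fc dimU]]]] := idem_summand red_surj red_ker ee.
  by move=> x Gx; apply: cbe; apply: rel_trace_hom.
apply: (IHn U (J *m map_mx red c)).
- apply: leq_trans len; rewrite dimU ebe eb ltn_neqAle rank_leq_row andbT.
  apply: contra nzW => fe; rewrite -[W]mulmx1.
  have /row_freeP[D <-] : row_free e0 by [].
  by rewrite mulmxA We mul0mx.
- exact: hprojective_retract hf hc fc hP.
split=> [x Gx|].
  by rewrite mulmxA hJ // -!mulmxA /= -!map_mxM hc.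
apply: contra nzJ => /eqP Jc0.
by rewrite -Je -eb -ebe -cf map_mxM mulmxA Jc0 mul0mx.
Qed.

(** Projective lattices are relatively injective too: J' extends along J to a homomorphism f from U
    to P. Its reduction is injective by essentiality, so f has a linear retraction over R, which is
    then averaged. *)
Lemma essential_summand d (S : mx_representation F G d) U J P J' :
    mx_irreducible S -> hprojective U -> @essential d S U J ->
    hprojective P -> @embedding d S P J' ->
  exists2 P2, hprojective P2 & lattice_iso P (dsum_lattice U P2).
Proof.
move=> irrS [u eu] [[hJ nzJ] ess] hP [hJ' nzJ']; have [t et] := hP.
have [f0 ef0] := lift_mx red_surj (pinvmx J *m J').
pose f := rel_trace U P (f0 *m t).
have et' : rel_trace (redr P) (redr P) (map_mx red t) = 1%:M.
  by rewrite -map_rel_trace et map_mx1.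
have Jf : J *m map_mx red f = J'.
  rewrite map_rel_trace (mul_rel_trace _ _ hJ) map_mxM ef0 2!(mulmxA J).
  rewrite mulmxVp ?(irr_hom_free irrS hJ) // mul1mx -(mul_rel_trace _ _ hJ').
  by rewrite et' mulmx1.
have hf : lattice_hom f by move=> x Gx; apply: rel_trace_hom.
have [C fC] : exists C, f *m C = 1%:M.
  apply: (row_free_red_inv red_surj red_ker); rewrite -kermx_eq0.
  apply/negPn/negP=> nzK; case/negP: nzJ'; rewrite -Jf.
  have /submxP[D ->] : (J <= kermx (map_mx red f))%MS.
    apply: ess nzK; apply/mxmoduleP=> x Gx; apply/sub_kermxP.
    rewrite -mulmxA -(map_mxM red (U x)) hf // map_mxM mulmxA mulmx_ker.
    by rewrite mul0mx.
  by rewrite -mulmxA mulmx_ker mulmx0.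
have hr : lattice_hom (rel_trace P U (C *m u)).
  by move=> x Gx; apply: rel_trace_hom.
apply: (retract_summand red_surj red_ker hf hr _ hP).
by rewrite (mul_rel_trace _ _ hf) mulmxA fC mul1mx.
Qed.

Lemma simple_embedding P : (0 < ldim P)%N ->
  exists d (S : mx_representation F G d) (J : 'M_(d, ldim P)),
    mx_irreducible S /\ embedding S J.
Proof.
move=> P0; apply: NNPP => noS.
have nz1 : 1%:M != 0 :> 'M[F]_(ldim P) by rewrite -mxrank_eq0 mxrank1 -lt0n.
suff: false by []; apply: (mxsimple_exists (mxmodule1 (redr P)) nz1) => -[V simV _].
case: noS; have [modV nzV _] := simV.
exists (\rank V), (submod_repr modV), (val_submod 1%:M); split.
  exact/submod_mx_irr.
split=> [x Gx|]; last by rewrite val_submod_eq0 -mxrank_eq0 mxrank1 mxrank_eq0.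
by rewrite -[LHS]val_submodE -(val_submodJ modV) // mul1mx.
Qed.

(* The trace of the idempotent [X |-> rel_trace S P (X t)], which projects the *)
(* space of all matrices onto the homomorphisms from S to the reduction of P. *)
Definition hom_trace d (S : mx_representation F G d) P (t : 'M_(ldim P)) : F :=
  \sum_i \sum_j rel_trace S (redr P) (delta_mx i j *m map_mx red t) i j.

Lemma hom_trace_embedding d (S : mx_representation F G d) P t :
  @hom_trace d S P t != 0 -> exists J, @embedding d S P J.
Proof.
move=> nzw; apply: NNPP => noJ; case/negP: nzw; apply/eqP.
apply: big1 => i _; apply: big1 => j _.
set E := rel_trace _ _ _; have [-> | nzE] := eqVneq E 0; first by rewrite mxE.
by case: noJ; exists E; split=> // x; apply: rel_trace_hom.
Qed.

(** The trace of X |-> A X B is the product of the traces of A and B. *)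
Lemma hom_traceE d (S : mx_representation F G d) P t :
  hom_trace S t = \sum_(x in G) \tr (S x^-1%g) * red (\tr (t *m P x)).
Proof.
rewrite /hom_trace (eq_bigr (fun i => \sum_(x in G) \sum_j
   S x^-1%g i i * map_mx red (t *m P x) j j)) => [|i _]; last first.
  rewrite exchange_big; apply: eq_bigr => j _; rewrite summxE.
  apply: eq_bigr => x Gx; rewrite map_mxM -[map_mx red (P x)]/(redr P x) -!mulmxA.
  rewrite -(@mul_delta_mx _ _ 1 _ 0) -!mulmxA mulmxA -colE -rowE.
  by rewrite mxE big_ord1 !mxE.
rewrite exchange_big; apply: eq_bigr => x Gx.
rewrite -trace_map_mx mulr_suml; apply: eq_bigr => i _.
by rewrite mulr_sumr.
Qed.

(** The sum is lifted to R, where |G| times it depends only on the character. The division by |G|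
    takes place in R, since |G| may vanish in F. *)
Lemma hom_trace_char d (S : mx_representation F G d) k P U P2 t u t2 :
    rel_trace P P t = 1%:M -> rel_trace U U u = 1%:M -> rel_trace P2 P2 t2 = 1%:M ->
    #|G|%:R != 0 :> R ->
    (forall x, x \in G -> \tr (P x) = \tr (U x) *+ k + \tr (P2 x)) ->
  hom_trace S t = hom_trace S u *+ k + hom_trace S t2.
Proof.
move=> et eu et2 nzG chiP.
have /fin_all_exists[l lP] : forall x : gT, exists y, red y = \tr (S x^-1%g).
  by move=> x; apply: red_surj.
(* One lift is chosen per conjugacy class, so that s is a class function. *)
pose s x := l (repr (x ^: G)).
have sP x : x \in G -> red (s x) = \tr (S x^-1%g).
  move=> Gx; rewrite lP; have /imsetP[y Gy ->] := mem_repr x (class_refl G x).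
  by rewrite -conjVg /conjg !repr_mxM ?groupM ?groupV // mxtrace_mulC -mulmxA
     -repr_mxM ?groupV // mulgV repr_mx1 mulmx1.
have sJ x y : y \in G -> s (x ^ y)%g = s x by move=> Gy; rewrite /s classGidl.
pose w (M : lattice R G) (v : 'M_(ldim M)) := \sum_(x in G) s x * \tr (v *m M x).
have wE M v : hom_trace S v = red (w M v).
  rewrite hom_traceE rmorph_sum; apply: eq_bigr => x Gx.
  by rewrite rmorphM sP.
(* Replacing x by all its conjugates turns t into its relative trace, the identity. *)
have wchi (M : lattice R G) v : rel_trace M M v = 1%:M ->
    w M v *+ #|G| = \sum_(x in G) s x * \tr (M x).
  move=> ev; rewrite -sumr_const.
  rewrite (eq_bigr (fun g => \sum_(x in G) s x * \tr (v *m M (x ^ g^-1)%g))).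
    rewrite exchange_big; apply: eq_bigr => x Gx.
    rewrite -mulr_sumr; congr (_ * _).
    rewrite -[M x]mulmx1 -ev mulmx_sumr linear_sum /=; apply: eq_bigr => g Gg.
    rewrite !mulmxA [in RHS]mxtrace_mulC !mulmxA -!repr_mxM ?groupM ?groupV //.
    by rewrite [in RHS]mxtrace_mulC conjgE invgK mulgA.
  move=> g Gg; rewrite (reindex_inj (conjg_inj g)) /=; apply: eq_big => x.
    by rewrite groupJr.
  by move=> Gx; rewrite sJ // conjgK.
rewrite !wE -rmorphMn -rmorphD; congr (red _).
apply: (mulIf nzG); rewrite mulrDl !mulr_natr mulrnAC !wchi //.
rewrite -sumrMnl -big_split; apply: eq_bigr => x Gx.
by rewrite chiP // mulrDr mulrnAr.
Qed.

(** By Schur's lemma and essentiality Hom(S, U/pi) is the line spanned by J, and a projection onto a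
    line has trace 1. *)
Lemma hom_trace_essential d (S : mx_representation F G d) U J u :
    mx_absolutely_irreducible S -> rel_trace U U u = 1%:M -> @essential d S U J ->
  hom_trace S u = 1.
Proof.
move=> absS eu [[hJ nzJ] ess]; have irrS := mx_abs_irrW absS.
have [i0 [j0 nzJ0]] : exists i, exists j, J i j != 0.
  apply: NNPP => noJ; case/negP: nzJ; apply/eqP/matrixP=> i j; rewrite mxE.
  by apply/eqP/negPn/negP=> nz; case: noJ; exists i, j.
have scal X : (forall x, x \in G -> S x *m X = X *m redr U x) ->
    X = (X i0 j0 / J i0 j0) *: J.
  move=> hX; have [-> | nzX] := eqVneq X 0; first by rewrite mxE mul0r scale0r.
  have fX := irr_hom_free irrS hX nzX.
  have /submxP[D eD] : (J <= X)%MS.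
    rewrite -(genmxE X); apply: ess; last by rewrite (eqmx_eq0 (genmxE X)).
    rewrite (eqmx_module _ (genmxE X)); apply/mxmoduleP=> x Gx.
    by rewrite -hX // submxMl.
  have /is_scalar_mxP[c ec] : is_scalar_mx D.
    apply: (mx_abs_irr_cent_scalar absS); apply/centgmxP=> x Gx.
    by apply: (row_free_inj fX); rewrite /= -!mulmxA -eD hX // mulmxA -eD -hJ.
  have eJ : J = c *: X by rewrite eD ec mul_scalar_mx.
  rewrite [in RHS]eJ scalerA !mxE.
  have nzX0 : c * X i0 j0 != 0 by move: nzJ0; rewrite eJ mxE.
  by rewrite mulrAC [X i0 j0 * c]mulrC mulfV ?scale1r.
rewrite /hom_trace.
pose E X := rel_trace S (redr U) (X *m map_mx red u).
have EJ : E J = J.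
  by rewrite /E -(mul_rel_trace _ _ hJ) -map_rel_trace eu map_mx1 mulmx1.
transitivity ((\sum_i \sum_j J i j *: E (delta_mx i j)) i0 j0 / J i0 j0).
  rewrite summxE mulr_suml; apply: eq_bigr => i _.
  rewrite summxE mulr_suml; apply: eq_bigr => j _.
  rewrite -/(E _) [in LHS](scal (E (delta_mx i j))) => [|x Gx].
    by rewrite !mxE mulrC mulrA.
  exact: rel_trace_hom.
suff -> : \sum_i \sum_j J i j *: E (delta_mx i j) = J by rewrite mulfV.
rewrite -[RHS]EJ {2}[J]matrix_sum_delta /E /rel_trace.
rewrite (eq_bigr (fun i => \sum_(x in G) \sum_j
   S x^-1%g *m (J i j *: delta_mx i j *m map_mx red u) *m redr U x)).
  rewrite exchange_big; apply: eq_bigr => x Gx.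
  rewrite !mulmx_suml mulmx_sumr mulmx_suml; apply: eq_bigr => i _.
  by rewrite !mulmx_suml mulmx_sumr mulmx_suml.
move=> i _; rewrite exchange_big; apply: eq_bigr => j _.
rewrite scaler_sumr; apply: eq_bigr => x Gx.
by rewrite -!scalemxAl -scalemxAr -scalemxAl.
Qed.

End ProjectiveCharacters.

Section Multiples.

Variables (R : comUnitRingType) (gT : finGroupType) (G : {group gT}).
Implicit Types P U M N : lattice R G.

Definition lattice_mul k P : lattice R G := iter k (dsum_lattice P) zero_lattice.

Lemma lattice_iso_dim0 M N : ldim M = 0 -> ldim N = 0 -> lattice_iso M N.
Proof.
case: M N => m M [n N] /= m0 n0; subst m n.
by exists 0, 0; split=> [x _||]; apply/matrixP=> [[]].
Qed.

Lemma ldim_mul k P : ldim (lattice_mul k P) = (k * ldim P)%N.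
Proof. by elim: k => //= k ->; rewrite mulSn. Qed.

Lemma mxtrace_mul k P x : \tr (lattice_mul k P x) = \tr (P x) *+ k.
Proof.
elim: k => [|k IHk]; first by rewrite /mxtrace big_ord0.
by rewrite [LHS]mxtrace_block IHk mulrS.
Qed.

Lemma lattice_mul_iso k M N :
  lattice_iso M N -> lattice_iso (lattice_mul k M) (lattice_mul k N).
Proof. by move=> iso; elim: k => //= k ->; rewrite iso. Qed.

Lemma lattice_mul_dsum k M N :
  lattice_iso (lattice_mul k (dsum_lattice M N))
              (dsum_lattice (lattice_mul k M) (lattice_mul k N)).
Proof.
elim: k => [|k IHk] /=; first by rewrite dsum_lattice0.
by rewrite IHk dsum_latticeACA.
Qed.

End Multiples.

Section CharacterDeterminesProjective.

Variables (R : idomainType) (F : fieldType) (red : {rmorphism R -> F}).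
Hypothesis red_surj : forall y : F, exists x : R, red x = y.
Hypothesis red_ker : forall x : R, (red x == 0) = (x \isn't a GRing.unit).
Hypothesis complR : complete_dvr R.
Hypothesis natR_inj : injective (fun n : nat => n%:R : R).
Variables (p : nat) (gT : finGroupType) (G : {group gT}).
Hypothesis charF : p \in [pchar F].
Hypothesis splitF : group_splitting_field F G.
Implicit Types P U : lattice R G.

Local Notation embedding := (embedding red).
Local Notation essential := (essential red).
Local Notation hom_trace := (hom_trace red).

Let p_prime : prime p := pcharf_prime charF.

Lemma ldim_iso P U : lattice_iso P U -> ldim P = ldim U.
Proof.
move/mxtrace_iso/(_ (group1 G)); rewrite !repr_mx1 !mxtrace1.
by move/natR_inj.
Qed.

Let nzG : #|G|%:R != 0 :> R.
Proof.
apply/eqP=> G0; have := @natR_inj #|G| 0%N G0.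
by apply/eqP; rewrite -lt0n cardG_gt0.
Qed.

Lemma essential_dim d (S : mx_representation F G d) U J :
  @essential _ _ d S U J -> (0 < ldim U)%N.
Proof.
case=> [[_ nzJ] _]; rewrite lt0n; apply: contra nzJ => /eqP U0.
apply/eqP/matrixP=> i j; have := leq_ltn_trans (leq0n j) (ltn_ord j).
by move=> ltj; have := leq_trans ltj (eq_leq U0).
Qed.

Definition all_hom_trace0 P :=
  forall d (S : mx_representation F G d) t,
    mx_irreducible S -> rel_trace P P t = 1%:M -> hom_trace S t = 0.

(** If fewer than p copies of U, say m > 0, have split off, the remainder has trace -m at S. This is
    nonzero in F, so S embeds in the remainder and one more copy splits off. *)
Lemma peel_multiple d (S : mx_representation F G d) U J P k :
    mx_irreducible S -> hprojective U -> @essential _ _ d S U J ->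
    hprojective P -> all_hom_trace0 P -> (0 < k <= p)%N ->
    (exists J', @embedding _ _ d S P J') ->
  exists2 P2, hprojective P2
    & lattice_iso P (dsum_lattice (lattice_mul k U) P2).
Proof.
move=> irrS hU essJ hP P0 /andP[k0 kp] [J' embJ'].
have [u eu] := hU; have [t et] := hP.
case: k k0 kp => // k _; elim: k => [|k IHk] kp.
  have [P2 hP2 iso] := essential_summand red_surj red_ker irrS hU essJ hP embJ'.
  by exists P2; rewrite //= (dsum_lattice0 U).
have [P2 hP2 iso] := IHk (ltnW kp); have [t2 et2] := hP2.
have [J2 embJ2] : exists J2, @embedding _ _ d S P2 J2.
  apply: (@hom_trace_embedding _ _ _ _ _ _ _ _ t2).
  have := hom_trace_char red_surj S et eu et2 nzG (k := k.+1).
  rewrite (P0 _ _ _ irrS et).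
  rewrite (hom_trace_essential (splitF irrS) eu essJ) => e0.
  apply/negP=> /eqP w0; have : (k.+1%:R == 0 :> F).
    rewrite -[k.+1%:R]addr0 -{1}w0 -e0 // => x Gx.
    by rewrite (mxtrace_iso iso) // [LHS]mxtrace_block mxtrace_mul.
  by rewrite -(dvdn_pcharf charF) => /dvdn_leq-/(_ isT); rewrite leqNgt kp.
have [P3 hP3 iso2] := essential_summand red_surj red_ker irrS hU essJ hP2 embJ2.
exists P3 => //; rewrite iso iso2 dsum_latticeA.
by rewrite (dsum_latticeC (lattice_mul k.+1 U)).
Qed.

(** Removing p copies of U leaves all traces zero, because p = 0 in F. *)
Lemma divide_by_p P : hprojective P -> all_hom_trace0 P ->
  exists2 P1, hprojective P1 & lattice_iso P (lattice_mul p P1).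
Proof.
have [n] := ubnP (ldim P); elim: n P => // n IHn P /ltnSE-len hP P0.
have [d0|] := posnP (ldim P).
  exists zero_lattice; first exact: hprojective_zero.
  by apply: lattice_iso_dim0; rewrite ?ldim_mul ?muln0.
move/(simple_embedding red) => [d [S [J [irrS embJ]]]].
have [U [JU [hU essJ]]] :=
  projective_indecomposable red_surj red_ker complR irrS hP embJ.
have pp : (0 < p <= p)%N by rewrite prime_gt0 ?leqnn.
have [P2 hP2 iso] := peel_multiple irrS hU essJ hP P0 pp (ex_intro _ J embJ).
have [P3 hP3 iso3] : exists2 P1, hprojective P1 & lattice_iso P2 (lattice_mul p P1).
  apply: (IHn P2) => //.
    apply: leq_trans len; rewrite (ldim_iso iso) /= ldim_mul -[X in (X < _)%N]add0n.
    rewrite ltn_add2r muln_gt0 prime_gt0 //=.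
    exact: essential_dim essJ.
  move=> d' S' t2 irrS' et2; have [t et] := hP; have [u eu] := hU.
  have := hom_trace_char red_surj S' et eu et2 nzG (k := p).
  rewrite (P0 _ _ _ irrS' et) -mulr_natr (pcharf0 charF) mulr0 add0r => -> //.
  by move=> x Gx; rewrite (mxtrace_iso iso) // [LHS]mxtrace_block mxtrace_mul.
exists (dsum_lattice U P3); first exact: hprojective_dsum.
by rewrite iso iso3 lattice_mul_dsum.
Qed.

Theorem projective_character_iso P P' :
    hprojective P -> hprojective P' ->
    (forall x, x \in G -> \tr (P x) = \tr (P' x)) ->
  lattice_iso P P'.
Proof.
have [n] := ubnP (ldim P); elim: n P P' => // n IHn P P' /ltnSE-len hP hP' chi.
have eqd : ldim P = ldim P'.
  by apply: natR_inj; have := chi _ (group1 G); rewrite !repr_mx1 !mxtrace1.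
have [d0|dP] := posnP (ldim P).
  by apply: lattice_iso_dim0; rewrite -?eqd.
have [[t et] [t' et']] := (hP, hP').
have [[d [S [[J embJ] [J' [irrS embJ']]]]] | noS] := classic
    (exists d (S : mx_representation F G d),
       (exists J, @embedding _ _ d S P J) /\
       exists J', mx_irreducible S /\ @embedding _ _ d S P' J').
  have [U [JU [hU essJ]]] :=
    projective_indecomposable red_surj red_ker complR irrS hP embJ.
  have [P2 hP2 iso] := essential_summand red_surj red_ker irrS hU essJ hP embJ.
  have [P2' hP2' iso'] := essential_summand red_surj red_ker irrS hU essJ hP' embJ'.
  rewrite iso iso' (IHn P2 P2') // => [|x Gx].
    apply: leq_trans len; rewrite (ldim_iso iso) /= -[X in (X < _)%N]add0n.
    rewrite ltn_add2r.
    exact: essential_dim essJ.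
  have := chi x Gx; rewrite (mxtrace_iso iso) // (mxtrace_iso iso') //.
  by rewrite !mxtrace_block => /addrI.
(* With k = 0, [hom_trace_char] gives P and P' the same trace; a nonzero value would embed S in both
   reductions, against [noS]. *)
have w0 d (S : mx_representation F G d) u u' : mx_irreducible S ->
    rel_trace P P u = 1%:M -> rel_trace P' P' u' = 1%:M ->
    hom_trace S u = 0 /\ hom_trace S u' = 0.
  move=> irrS eu eu'.
  have := hom_trace_char red_surj S eu eu' eu' nzG (k := 0).
  rewrite mulr0n add0r => ew.
  have {}ew : hom_trace S u = hom_trace S u'.
    by apply: ew => x Gx; rewrite mulr0n add0r chi.
  rewrite -ew; have [//|nzw] := eqVneq (hom_trace S u) 0.
  case: noS; exists d, S; split; first exact: hom_trace_embedding nzw.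
  rewrite ew in nzw; have [J' eJ'] := hom_trace_embedding nzw.
  by exists J'.
have [|P1 hP1 iso] := divide_by_p hP.
  by move=> d S u irrS eu; have [] := w0 d S u t' irrS eu et'.
have [|P1' hP1' iso'] := divide_by_p hP'.
  by move=> d S u irrS eu; have [] := w0 d S t u irrS et eu.
rewrite iso iso'; apply: lattice_mul_iso; apply: IHn => // [|x Gx].
  apply: leq_trans len; move: dP; rewrite (ldim_iso iso) ldim_mul muln_gt0.
  by case/andP=> _ P10; rewrite -{1}[ldim P1]mul1n ltn_mul2r P10 prime_gt1.
have := chi x Gx; rewrite (mxtrace_iso iso) // (mxtrace_iso iso') //.
rewrite !mxtrace_mul => chip.
have nzp : p%:R != 0 :> R.
  by apply/eqP=> /(@natR_inj p 0%N) p0; move: p_prime; rewrite p0.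
by apply: (mulIf nzp); rewrite !mulr_natr.
Qed.

End CharacterDeterminesProjective.

(** * Characters of projective lattices *)

Section InducedTrace.

Variables (R : comUnitRingType) (gT : finGroupType) (H G : {group gT}).
Hypothesis sHG : H \subset G.

Lemma mxtrace_induced (M : lattice R H) x :
  \tr (induced_lattice G M x) =
    \sum_(i < #|rcosets H G|) (if (coset_rep i * x * (coset_rep i)^-1)%g \in H
       then \tr (M (coset_rep i * x * (coset_rep i)^-1)%g) else 0).
Proof.
rewrite [LHS]mxtrace_mxblock; apply: eq_bigr => i _ /=.
by case: ifP; rewrite ?mxtrace0.
Qed.

Lemma sum_rcosets (V : nmodType) (f : gT -> V) :
  \sum_(g in G) f g =
    \sum_(i < #|rcosets H G|) \sum_(h in H) f (h * coset_rep i)%g.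
Proof.
rewrite (eq_bigr (fun g => \sum_(i < #|rcosets H G|)
           if (g * (coset_rep i)^-1)%g \in H then f g else 0)) => [|g Gg].
  rewrite exchange_big; apply: eq_bigr => i _.
  rewrite -big_mkcondr (reindex_inj (mulIg (coset_rep i))) /=.
  apply: eq_bigl => h; rewrite mulgK groupMr ?coset_rep_in //.
  by apply: andb_idl => /(subsetP sHG).
have [i Hi] := coset_rep_ex H Gg.
rewrite (bigD1 i) //= Hi big1 ?addr0 // => j nij.
case: ifP => // Hj; case/eqP: nij; apply: coset_rep_inj.
by have := groupM (groupVr Hj) Hi; rewrite invMg invgK !mulgA mulgKV.
Qed.

Lemma mxtrace_conj (K : {group gT}) (M : lattice R K) x g :
  x \in K -> g \in K -> \tr (M (g * x * g^-1)%g) = \tr (M x).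
Proof.
move=> Kx Kg; rewrite !repr_mxM ?groupM ?groupV // mxtrace_mulC mulmxA.
by rewrite -repr_mxM ?groupV // mulVg repr_mx1 mul1mx.
Qed.

(** Frobenius' formula, cleared of the denominator |H|. *)
Lemma mxtrace_induced_sum (M : lattice R H) x :
  \tr (induced_lattice G M x) *+ #|H| =
    \sum_(g in G) (if (g * x * g^-1)%g \in H then \tr (M (g * x * g^-1)%g) else 0).
Proof.
rewrite mxtrace_induced sum_rcosets -sumrMnl; apply: eq_bigr => i _.
rewrite -sumr_const; apply: eq_bigr => h Hh.
have -> : (h * coset_rep i * x * (h * coset_rep i)^-1 =
           h * (coset_rep i * x * (coset_rep i)^-1) * h^-1)%g.
  by rewrite invMg !mulgA.
rewrite (groupMr _ (groupVr Hh)) (groupMl _ Hh); case: ifP => // Hx.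
by rewrite mxtrace_conj.
Qed.

End InducedTrace.

(** * Actions of p-groups and covers of coinvariants *)

Section FixedColumns.

Variables (F : fieldType) (p : nat) (gT : finGroupType) (Q : {group gT}).
Hypothesis charF : p \in [pchar F].
Hypothesis pQ : p.-group Q.

Lemma dual_mx_repr n (N : mx_representation F Q n) :
  mx_repr Q (fun q => (N q^-1%g)^T).
Proof.
split=> [|x y Qx Qy]; first by rewrite invg1 repr_mx1 trmx1.
by rewrite invMg repr_mxM ?groupV // trmx_mul.
Qed.

(** Dually, the kernel of the transpose of B is a nonzero Q-module in characteristic p, and a
    p-group has nonzero fixed vectors there. *)
Lemma pgroup_fixed_column n (N : mx_representation F Q n) (B : 'M[F]_n) :
    (forall q, q \in Q -> N q *m B = B *m N q) -> B \notin unitmx ->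
  exists c : 'cV[F]_n,
    [/\ c != 0, B *m c = 0 & forall q, q \in Q -> N q *m c = c].
Proof.
move=> cNB nuB; pose D := MxRepresentation (dual_mx_repr N).
have modK : mxmodule D (kermx B^T).
  apply/mxmoduleP=> q Qq; apply/sub_kermxP.
  by rewrite -mulmxA -trmx_mul -cNB ?groupV // trmx_mul mulmxA mulmx_ker mul0mx.
have K0 : (0 < \rank (kermx B^T))%N.
  by rewrite lt0n mxrank_eq0 kermx_eq0 row_free_unit unitmx_tr.
have := rfix_pgroup_pchar charF (submod_repr modK) K0 pQ (subxx _).
set W := rfix_mx _ _ => nzW.
have [i nzi] : exists i, row i W != 0.
  apply/existsP; rewrite -negb_forall; apply: contra nzW => /forallP W0.
  by apply/eqP/row_matrixP=> i; rewrite row0; apply/eqP.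
pose v := val_submod (row i W).
exists v^T; split.
- by rewrite -(inj_eq (can_inj (@trmxK _ _ _))) trmxK trmx0 val_submod_eq0.
- apply: trmx_inj; rewrite trmx_mul trmxK trmx0.
  by apply/sub_kermxP; apply: val_submodP.
move=> q Qq; apply: trmx_inj; rewrite trmx_mul trmxK.
have -> : (N q)^T = D q^-1%g by rewrite /= invgK.
rewrite -val_submodJ ?groupV // -row_mul.
by rewrite rfix_mx_id ?groupV.
Qed.

End FixedColumns.

Section Covers.

Variables (R : idomainType) (F : fieldType) (red : {rmorphism R -> F}).
Hypothesis red_ker : forall x : R, (red x == 0) = (x \isn't a GRing.unit).
Variables (p : nat) (gT : finGroupType).
Hypothesis charF : p \in [pchar F].
Implicit Types C Q H : {group gT}.

(* The kernel of [f] is spanned by the differences [u - u q] modulo the       *)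
(* maximal ideal; dually, every Q-invariant linear form on the reduction of P *)
(* factors through [f].                                                       *)
Definition coinvariant_cover C Q (P A : lattice R C)
    (f : 'M_(ldim P, ldim A)) (s : 'M_(ldim A, ldim P)) :=
  [/\ lattice_hom f, s *m f = 1%:M
    & forall c : 'cV[F]_(ldim P),
        (forall q, q \in Q -> map_mx red (P q) *m c = c) ->
        map_mx red (f *m s) *m c = c].

(** A form of Nakayama's lemma. Were a singular modulo the maximal ideal, it would kill a nonzero
    Q-fixed c; but c = f s c, and a f = f gives a c = c. *)
Lemma coinvariant_nakayama C Q (P A : lattice R C) f s (a : 'M_(ldim P)) :
    Q \subset C -> p.-group Q -> @coinvariant_cover C Q P A f s ->
    (forall q, q \in Q -> P q *m a = a *m P q) -> a *m f = f ->
  a \in unitmx.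
Proof.
move=> sQC pQ [_ _ cov] ca af; rewrite (unitmx_red red_ker).
apply/negPn/negP=> nua.
have [q Qq|c [nzc ac fixc]] := pgroup_fixed_column charF pQ
    (N := subg_repr (map_repr red P) sQC) _ nua.
  by rewrite /= -!map_mxM ca.
case/negP: nzc; have := cov c fixc => ec.
by rewrite -ec -af -mulmxA map_mxM -mulmxA ec ac.
Qed.

(** Projectivity lifts each cover through the other, and both composites are invertible by
    [coinvariant_nakayama]. *)
Lemma coinvariant_cover_iso C Q (P1 P2 A : lattice R C) f1 s1 f2 s2 :
    Q \subset C -> p.-group Q -> hprojective P1 -> hprojective P2 ->
    @coinvariant_cover C Q P1 A f1 s1 -> @coinvariant_cover C Q P2 A f2 s2 ->
  lattice_iso P1 P2.
Proof.
move=> sQC pQ hP1 hP2 cov1 cov2.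
have [[hf1 sf1 _] [hf2 sf2 _]] := (cov1, cov2).
have [h hh hf] := hprojective_lift hP1 hf1 hf2 sf2.
have [k hk kf] := hprojective_lift hP2 hf2 hf1 sf1.
have u : h *m k \in unitmx.
  apply: (coinvariant_nakayama sQC pQ cov1) => [q Qq|]; last by rewrite -mulmxA kf.
  by rewrite mulmxA hh ?(subsetP sQC) // -!mulmxA hk ?(subsetP sQC).
have u' : k *m h \in unitmx.
  apply: (coinvariant_nakayama sQC pQ cov2) => [q Qq|]; last by rewrite -mulmxA hf.
  by rewrite mulmxA hk ?(subsetP sQC) // -!mulmxA hh ?(subsetP sQC).
have hr : h *m (k *m invmx (h *m k)) = 1%:M by rewrite mulmxA mulmxV.
have lh : (invmx (k *m h) *m k) *m h = 1%:M by rewrite -mulmxA mulVmx.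
exists h, (k *m invmx (h *m k)); split=> //.
rewrite -[k *m _]mul1mx -lh -(mulmxA _ h) hr mulmx1.
by rewrite -mulmxA mulVmx.
Qed.

Section InducedCover.

Variables C Q H : {group gT}.
Hypotheses (sQC : Q \subset C) (sHC : H \subset C) (sCHQ : C \subset (H * Q)%g).
Variable A : lattice R C.
Hypothesis A1 : forall q, q \in Q -> A q = 1%:M.

Let X := induced_lattice C (res_lattice sHC A).

(** The map f is the action map from Ind Res A to A. As C = H Q, the group Q permutes the cosets of
    H transitively, so a Q-fixed form is determined by its component at [i0]. *)
Lemma induced_coinvariant_cover : exists f s, @coinvariant_cover C Q X A f s.
Proof.
have [i0 Hi0] := coset_rep_ex H (group1 C).
have rC := coset_rep_in sHC.
pose f : 'M_(ldim X, ldim A) := \mxcol_(i < #|rcosets H C|) A (coset_rep i).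
pose s : 'M_(ldim A, ldim X) := \mxrow_(j < #|rcosets H C|)
  (if j == i0 then A (coset_rep i0)^-1%g else 0).
exists f, s; split.
- move=> g Cg; rewrite mul_mxblock_mxrow mxcol_mul; apply: eq_mxcol => i.
  have [j Hj] := coset_rep_ex H (groupM (rC i) Cg).
  rewrite (bigD1 j) //= big1 ?addr0 => [|k nkj].
    rewrite Hj -!repr_mxM ?groupM ?groupV ?rC //.
    by rewrite mulgKV.
  case: ifP => Hk; last by rewrite mul0mx.
  case/eqP: nkj; apply: coset_rep_inj.
  by have := groupM (groupVr Hk) Hj; rewrite !invMg invgK !mulgA mulgKV mulgKV.
- rewrite mul_mxrow_mxcol (bigD1 i0) //= eqxx big1 ?addr0.
    by rewrite -repr_mxM ?groupV ?rC // mulVg repr_mx1.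
  by move=> i /negPf ->; rewrite mul0mx.
move=> c cQ.
have map_mxblock m1 m2 (p_ : 'I_m1 -> nat) (q_ : 'I_m2 -> nat)
   (B_ : forall i j, 'M[R]_(p_ i, q_ j)) :
   map_mx red (\mxblock_(i, j) B_ i j) = \mxblock_(i, j) map_mx red (B_ i j).
  by apply/matrixP=> i j; rewrite !mxE.
(* The element q0^-1 q of Q moves the coset [i0] to the coset i. *)
have c0 i : map_mx red (A (coset_rep i)) *m
     (map_mx red (A (coset_rep i0)^-1%g) *m submxcol c i0) = submxcol c i.
  have /mulsgP[h0 q0 Hh0 Qq0 e0] := subsetP sCHQ _ (rC i0).
  have /mulsgP[h q Hh Qq e] := subsetP sCHQ _ (rC i).
  have Qqq : (q0^-1 * q)%g \in Q by rewrite groupM ?groupV.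
  have Hr : (coset_rep i0 * (q0^-1 * q) * (coset_rep i)^-1)%g \in H.
    by rewrite e0 e invMg !mulgA mulgK mulgK groupM ?groupV.
  move: (q0^-1 * q)%g Qqq Hr => z Qqq Hr.
  have -> : submxcol c i0 =
      map_mx red (A (coset_rep i0 * (coset_rep i)^-1)%g) *m submxcol c i.
    rewrite -{1}(cQ _ Qqq) -{1}[c]submxcolK /= map_mxblock mul_mxblock_mxrow mxcolK.
    rewrite (bigD1 i) //= big1 ?addr0 => [|k nki].
      rewrite Hr !repr_mxM ?groupM ?groupV ?rC ?(subsetP sQC) //.
      by rewrite (A1 Qqq) mulmx1.
    case: ifP => Hk; last by rewrite map_mx0 mul0mx.
    case/eqP: nki; apply: coset_rep_inj.
    by have := groupM (groupVr Hk) Hr; rewrite !invMg !invgK !mulgA mulgKV mulgKV.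
  rewrite mulmxA mulmxA -!map_mxM -!repr_mxM ?groupM ?groupV ?rC //.
  by rewrite !mulgA mulgKV mulgV repr_mx1 map_mx1 mul1mx.
apply/mxcolP=> i.
have -> : map_mx red (f *m s) = map_mx red f *m map_mx red s by rewrite map_mxM.
have -> : map_mx red f = \mxcol_i map_mx red (A (coset_rep i)).
  by apply/matrixP=> k l; rewrite !mxE.
have -> : map_mx red s =
    \mxrow_j (if j == i0 then map_mx red (A (coset_rep i0)^-1%g) else 0).
  by apply/matrixP=> k l; rewrite !mxE; case: ifP; rewrite ?mxE ?rmorph0.
rewrite -{1}[c]submxcolK -mulmxA mul_mxrow_mxcol mxcol_mul mxcolK.
rewrite (bigD1 i0) //= eqxx big1 ?addr0 => [|k /negPf ->]; last by rewrite mul0mx.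
exact: c0.
Qed.

End InducedCover.

End Covers.

Section CoverTraces.

Variables (R : idomainType) (F : fieldType) (red : {rmorphism R -> F}).
Hypothesis red_surj : forall y : F, exists x : R, red x = y.
Hypothesis red_ker : forall x : R, (red x == 0) = (x \isn't a GRing.unit).
Variables (p : nat) (gT : finGroupType).
Hypothesis charF : p \in [pchar F].
Implicit Types C Q H G : {group gT}.

Let p_prime : prime p := pcharf_prime charF.

Lemma pnat_unit n : p^'.-nat n -> (n%:R : R) \is a GRing.unit.
Proof.
move=> pn; apply/negPn; rewrite -red_ker rmorph_nat -(dvdn_pcharf charF).
by rewrite -p'natE.
Qed.

(** P and Ind Res A are both projective covers of the coinvariants A, the latter because |H| is a
    unit of R. *)
Lemma mxtrace_cover C Q H (sHC : H \subset C) (P A : lattice R C) f s y :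
    Q \subset C -> C \subset (H * Q)%g -> p.-group Q -> p^'.-group H ->
    hprojective P -> @coinvariant_cover _ _ red _ C Q P A f s ->
    (forall q, q \in Q -> A q = 1%:M) -> y \in C ->
  \tr (P y) = \tr (induced_lattice C (res_lattice sHC A) y).
Proof.
move=> sQC sCHQ pQ pH hP cov A1 Cy.
have [f' [s' cov']] := induced_coinvariant_cover red sQC sHC sCHQ A1.
apply: mxtrace_iso Cy.
apply: (coinvariant_cover_iso red_ker charF sQC pQ hP _ cov cov').
apply: (hprojective_induced sHC); apply: hprojective_unit.
exact: pnat_unit.
Qed.

(** With N the sum of the elements of Q acting on P, N t N = N, so t N is idempotent; A is its
    image, on which Q acts trivially as N q = N. *)
Lemma coinvariants_exist C Q (P : lattice R C) :
    Q <| C -> hprojective P ->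
  exists (A : lattice R C) f s, @coinvariant_cover _ _ red _ C Q P A f s /\
    forall q, q \in Q -> A q = 1%:M.
Proof.
move=> nQC hP; have [sQC nQ] := andP nQC.
have [t et] := hprojective_res sQC hP.
pose N := \sum_(q in Q) P q.
have QN q : q \in Q -> P q *m N = N.
  move=> Qq; rewrite mulmx_sumr [RHS](reindex_inj (mulgI q)) /=.
  apply: eq_big => x; first by rewrite groupMl.
  by move=> Qx; rewrite repr_mxM ?(subsetP sQC).
have NQ q : q \in Q -> N *m P q = N.
  move=> Qq; rewrite mulmx_suml [RHS](reindex_inj (mulIg q)) /=.
  apply: eq_big => x; first by rewrite groupMr.
  by move=> Qx; rewrite repr_mxM ?(subsetP sQC).
have NC g : g \in C -> P g *m N = N *m P g.
  move=> Cg; rewrite mulmx_sumr mulmx_suml (reindex_inj (conjg_inj g)) /=.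
  apply: eq_big => x; first by rewrite memJ_norm ?(subsetP nQ).
  rewrite memJ_norm ?(subsetP nQ) // => /(subsetP sQC) Cx.
  by rewrite -!repr_mxM ?groupJ // -conjgC.
have NtN : N *m t *m N = N.
  rewrite -[RHS]mulmx1 -et mulmx_sumr /rel_trace mulmx_sumr; apply: eq_bigr => q Qq.
  by rewrite !mulmxA NQ ?groupV.
have [|r [a [b [ab ba _]]]] := split_idem red_surj red_ker (e := t *m N).
  by rewrite -mulmxA (mulmxA N) NtN.
have bE : b *m (t *m N) = b by rewrite -ab mulmxA ba mul1mx.
have Arepr : mx_repr C (fun g => b *m P g *m a).
  split=> [|x y Cx Cy]; first by rewrite repr_mx1 mulmx1.
  have -> : b *m P x *m a *m (b *m P y *m a) = b *m P x *m (a *m b) *m P y *m a.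
    by rewrite !mulmxA.
  have -> : b *m P x *m (a *m b) = b *m P x.
    rewrite ab -{1}bE -!mulmxA (mulmxA (P x)).
    have -> : N *m (P x *m t *m N) = P x *m N.
      by rewrite -mulmxA mulmxA -NC // -mulmxA (mulmxA N) NtN.
    by rewrite NC // (mulmxA t) mulmxA bE.
  by rewrite repr_mxM // !mulmxA.
pose A := Lattice (MxRepresentation Arepr).
exists A, (N *m a), (b *m t); split; last first.
  move=> q Qq /=; rewrite -bE -!mulmxA (mulmxA N) NQ // mulmxA mulmxA -(mulmxA b).
  by rewrite bE ba.
split=> [x Cx /=||c cQ].
- rewrite mulmxA NC // -!mulmxA (mulmxA a) ab !mulmxA NtN.
  by [].
- by rewrite -!mulmxA (mulmxA t) -ab -mulmxA ba mulmx1 ba.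
have -> : N *m a *m (b *m t) = N *m t.
  by rewrite -mulmxA (mulmxA a) ab !mulmxA NtN.
have /(congr1 (fun M => map_mx red M *m c)) := et.
rewrite map_mx1 mul1mx => {2}<-; rewrite map_mxM /N /rel_trace.
rewrite !(raddf_sum (map_mx red)) !mulmx_suml (reindex_inj invg_inj) /=.
apply: eq_big => q; first by rewrite groupV.
by rewrite groupV => Qq; rewrite !map_mxM -!mulmxA cQ.
Qed.

(** On <y>, P is induced from the subgroup generated by the p'-part of y, which contains no
    conjugate of y under the abelian group <y>. *)
Lemma hprojective_singular0 G (P : lattice R G) y :
  hprojective P -> y \in G -> ~~ p^'.-elt y -> \tr (P y) = 0.
Proof.
move=> hP Gy sy; set C := <[y]>%G; set Q := <[y.`_p]>%G; set H := <[y.`_p^']>%G.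
have sCG : C \subset G by rewrite cycle_subG.
have sQC : Q \subset C by rewrite cycle_subG groupX ?cycle_id // mem_cycle.
have sHC : H \subset C by rewrite cycle_subG mem_cycle.
have nQC : Q <| C.
  rewrite /normal sQC (subset_trans _ (cent_sub _)) //.
  exact: (sub_abelian_cent (cycle_abelian y)).
have hPC := hprojective_res sCG hP.
have [A [f [s [cov A1]]]] := coinvariants_exist nQC hPC.
rewrite -[P y]/(res_lattice sCG P y).
have Cy : y \in C := cycle_id y.
rewrite (mxtrace_cover sHC sQC _ _ _ hPC cov A1 Cy); last first.
- exact: p_elt_constt.
- exact: p_elt_constt.
- apply/subsetP=> x /cycleP[k ->]; rewrite -{1}(consttC p y).
  rewrite expgMn; last by apply: commuteX2.
  rewrite -(centsP (cycle_abelian y)) ?mem_cycle ?groupX ?mem_cycle //.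
  by rewrite mem_mulg // mem_cycle.
rewrite mxtrace_induced big1 // => i _; case: ifP => // yH; case/negP: sy.
have Cr := coset_rep_in sHC i.
have := mem_p_elt _ yH; rewrite -(centsP (cycle_abelian y) y) ?cycle_id // mulgK.
by apply; apply: p_elt_constt.
Qed.

End CoverTraces.

(** * Characters of projective covers of inflated lattices *)

Section ProjectiveCoverTrace.

Variables (R : idomainType) (F : fieldType) (red : {rmorphism R -> F}).
Hypothesis red_ker : forall x : R, (red x == 0) = (x \isn't a GRing.unit).
Variables (p : nat) (gT : finGroupType).
Hypothesis charF : p \in [pchar F].
Variables (G Q : {group gT}).
Hypotheses (sQG : Q \subset G) (pQ : p.-group Q).
Variables (A : lattice R ('N_G(Q) / Q)) (P : lattice R 'N_G(Q)).

Local Notation N := 'N_G(Q)%G.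

Let sQN : Q \subset N.
Proof. by rewrite subsetI sQG normG. Qed.

Let nQN : N \subset 'N(Q).
Proof. exact: subsetIr. Qed.

Lemma inflationE x : inflation A x = A (coset Q x).
Proof. by []. Qed.

Lemma inflation_ker q : q \in Q -> inflation A q = 1%:M.
Proof. by move=> Qq; rewrite inflationE coset_id // repr_mx1. Qed.

Let repr_N (x : coset_of Q) : x \in (N / Q)%g -> repr x \in N.
Proof.
case/morphimP=> n nn Nn ->; rewrite val_coset //.
by case: repr_rcosetP => q Qq; rewrite groupM // (subsetP sQN).
Qed.

(** The vectors that Q-invariant forms cannot tell from the image of s make up a submodule; together
    with the kernel of f it spans P, so by minimality of the cover it is all of P. *)
Lemma projective_cover_coinvariant :
  projective A -> projective_cover P (inflation A) ->
  exists f s, @coinvariant_cover _ _ red _ N Q P (inflation A) f s.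
Proof.
move=> /projective_hprojective[t et] [_ [f [hf surj_f ess]]].
have [s0 s0f] : exists s0, s0 *m f = 1%:M.
  have /fin_all_exists[v vP] : forall i, exists v : 'rV_(ldim P), v *m f = row i 1%:M.
    by move=> i; apply: surj_f.
  exists (\matrix_i v i); apply/row_matrixP=> i.
  by rewrite row_mul rowK vP.
(* The section [s0] averaged over N/Q through representatives: it is equivariant up to elements of
   Q, which invariant forms do not see ([sP]). *)
pose s := \sum_(x in (N / Q)%g) A x^-1%g *m t *m s0 *m P (repr x).
have sf : s *m f = 1%:M.
  rewrite mulmx_suml -et; apply: eq_bigr => x NQx.
  rewrite -[LHS]mulmxA hf ?repr_N // inflationE coset_reprK.
  by rewrite mulmxA -(mulmxA _ s0 f) s0f mulmx1.
pose Qinv (c : 'cV[F]_(ldim P)) :=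
  forall q, q \in Q -> map_mx red (P q) *m c = c.
have Qinv_mul g c : g \in N -> Qinv c -> Qinv (map_mx red (P g) *m c).
  move=> Ng cQ q Qq; rewrite mulmxA -map_mxM.
  have Qqg : (q ^ g)%g \in Q by rewrite memJ_norm // (subsetP nQN).
  have [Nq Nqg] := (subsetP sQN q Qq, subsetP sQN _ Qqg).
  rewrite -repr_mxM // (conjgC q g) repr_mxM //.
  by rewrite map_mxM -mulmxA cQ.
have sP g c : g \in N -> Qinv c ->
    map_mx red (s *m P g) *m c = map_mx red (inflation A g *m s) *m c.
  move=> Ng cQ; have NQg : coset Q g \in (N / Q)%g by apply: mem_quotient.
  rewrite /s mulmx_suml mulmx_sumr !(raddf_sum (map_mx red)) !mulmx_suml.
  rewrite [RHS](reindex_inj (mulIg (coset Q g))) /=.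
  apply: eq_big => x; first by rewrite groupMr.
  move=> NQx; have NQxg := groupM NQx NQg.
  have -> : inflation A g *m
     (A (x * coset Q g)^-1%g *m t *m s0 *m P (repr (x * coset Q g)%g)) =
     A x^-1%g *m t *m s0 *m P (repr (x * coset Q g)%g).
    rewrite inflationE !mulmxA -repr_mxM ?groupV //.
    by rewrite invMg mulgA mulgV mul1g.
  rewrite -mulmxA -repr_mxM ?repr_N // !map_mxM -!mulmxA; do 3!congr (_ *m _).
  have [q Qq ->] : exists2 q, q \in Q & (repr x * g = repr (x * coset Q g) * q)%g.
    exists ((repr (x * coset Q g))^-1 * (repr x * g))%g; last by rewrite mulKVg.
    have n1 : repr x \in 'N(Q) by rewrite (subsetP nQN) ?repr_N.
    have n2 : repr (x * coset Q g)%g \in 'N(Q) by rewrite (subsetP nQN) ?repr_N.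
    have n3 : g \in 'N(Q) by rewrite (subsetP nQN).
    apply: coset_idr; first by rewrite !(groupM, groupV).
    rewrite !morphM ?morphV ?groupM ?groupV //= !coset_reprK.
    have -> : coset Q (repr (x * coset Q g)%g) = (x * coset Q g)%g.
      exact: coset_reprK.
    by rewrite mulVg.
  have Nq := subsetP sQN q Qq.
  by rewrite repr_mxM ?repr_N // map_mxM -mulmxA cQ.
pose U (v : 'rV[R]_(ldim P)) :=
  exists a : 'rV_(ldim A), forall c, Qinv c -> map_mx red (v - a *m s) *m c = 0.
have Uall v : U v.
  apply: ess; last first.
    move=> w; exists (w *m f *m s); last first.
      by rewrite mulmxBl -(mulmxA _ s) sf mulmx1 subrr.
    by exists (w *m f) => c _; rewrite subrr map_mx0 mul0mx.
  split.
  - by exists 0 => c _; rewrite mul0mx subrr map_mx0 mul0mx.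
  - move=> u w [a aP] [b bP]; exists (a + b) => c cQ.
    by rewrite mulmxDl opprD addrACA map_mxD mulmxDl aP // bP // addr0.
  - move=> k u [a aP]; exists (k *: a) => c cQ.
    by rewrite -scalemxAl -scalerBr map_mxZ -scalemxAl aP // scaler0.
  move=> x u Nx [a aP]; exists (a *m inflation A x) => c cQ.
  have := aP _ (Qinv_mul x c Nx cQ); rewrite mulmxA -map_mxM mulmxBl.
  rewrite !map_mxB !mulmxBl => /eqP; rewrite subr_eq0 => /eqP ->.
  rewrite -(mulmxA a) -(mulmxA a) (map_mxM red a) (map_mxM red a) -!mulmxA.
  by rewrite sP // subrr.
exists f, s; split=> // c cQ; apply/eqP; rewrite -subr_eq0 -opprB oppr_eq0.
have -> : c - map_mx red (f *m s) *m c = map_mx red (1%:M - f *m s) *m c.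
  by rewrite map_mxB map_mx1 mulmxBl mul1mx.
apply/eqP/row_matrixP=> i; rewrite row_mul row0 -map_row.
set v := row i _; have [a aP] := Uall v.
have vf : v *m f = 0.
  by rewrite -row_mul mulmxBl mul1mx -mulmxA sf mulmx1 subrr row0.
(* The columns of the reduction of f are Q-invariant, as Q acts trivially on A; pairing v - a s with
   them gives -a. *)
have a0 : map_mx red a = 0.
  have : map_mx red ((v - a *m s) *m f) = 0.
    apply: trmx_inj; apply/row_matrixP=> j; rewrite -tr_col trmx0 row0.
    rewrite map_mxM colE -mulmxA -colE aP ?trmx0 // => q Qq.
    rewrite !colE mulmxA -map_mxM hf ?(subsetP sQN) //.
    by rewrite inflation_ker // mulmx1.
  rewrite mulmxBl vf sub0r -mulmxA sf mulmx1 map_mxN => /eqP.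
  by rewrite oppr_eq0 => /eqP.
have := aP c cQ; rewrite map_mxB mulmxBl map_mxM a0 !mul0mx subr0.
by [].
Qed.

(** On <y>Q the cover is induced from <y>, and the g that conjugate y into <y> form <y> C_Q(y). *)
Lemma mxtrace_projective_cover y :
    projective A -> projective_cover P (inflation A) ->
    y \in N -> p^'.-elt y ->
  \tr (P y) = \tr (A (coset Q y)) *+ #|'C_Q[y]|.
Proof.
move=> pA covP Ny py; have [f [s cov]] := projective_cover_coinvariant pA covP.
set H := <[y]>%G; set C := (H <*> Q)%G.
have nQH : H \subset 'N(Q) by rewrite cycle_subG (subsetP nQN).
have sHN : H \subset N by rewrite cycle_subG.
have sCN : C \subset N by rewrite join_subG sHN.
have sQC : Q \subset C := joing_subr _ _.
have sHC : H \subset C := joing_subl _ _.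
have eC : C = (H * Q)%g :> {set gT} by rewrite /= norm_joinEl.
have hP : hprojective (res_lattice sCN P).
  by apply: hprojective_res; apply: projective_hprojective; case: covP.
have cov' : @coinvariant_cover _ _ red _ C Q (res_lattice sCN P)
    (res_lattice sCN (inflation A)) f s.
  have [hf sf fs] := cov; split=> // x Cx; apply: hf; exact: (subsetP sCN).
have Cy : y \in C by rewrite (subsetP sHC) ?cycle_id.
have -> : \tr (P y) = \tr (induced_lattice C
    (res_lattice sHC (res_lattice sCN (inflation A))) y).
  apply: (mxtrace_cover red_ker charF sHC sQC _ pQ py hP cov' _ Cy).
    by rewrite eC.
  by move=> q; apply: inflation_ker.
have natH : (#|H|%:R : R) != 0.
  have := pnat_unit red_ker charF (py : p^'.-nat #|H|).
  by apply: contraL => /eqP ->; rewrite unitr0.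
apply: (mulIf natH); rewrite !mulr_natr (mxtrace_induced_sum sHC).
have tI : H :&: Q = 1%g.
  by apply: coprime_TIg; rewrite coprime_sym (pnat_coprime pQ).
rewrite (eq_bigr (fun g => if (g * y * g^-1)%g \in H then \tr (A (coset Q y)) else 0)).
  rewrite -big_mkcondr sumr_const -mulrnA mulnC.
  (* If q y q^-1 lies in H, then q y q^-1 y^-1 lies in both H and Q, hence is trivial. *)
  have -> : #|[pred g in C | (g * y * g^-1)%g \in H]| = #|(H * 'C_Q[y])%g|.
    apply: eq_card => g; rewrite inE /= eC.
    apply/andP/mulsgP=> [[/mulsgP[h q Hh Qq ->]] | [h q Hh /setIP[Qq cq] ->]].
      have -> : (h * q * y * (h * q)^-1 = h * (q * y * q^-1) * h^-1)%g.
        by rewrite invMg !mulgA.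
      rewrite groupMr ?groupV // groupMl // => Hq; exists h q => //.
      apply/setIP; split=> //; apply/cent1P.
      have : (q * y * q^-1 * y^-1)%g \in H :&: Q.
        rewrite inE groupM ?groupV ?cycle_id //=.
        have -> : (q * y * q^-1 * y^-1 = q * (q^-1) ^ y^-1)%g.
          by rewrite conjgE invgK !mulgA.
        by rewrite groupM // memJ_norm ?groupV // (subsetP nQN).
      rewrite tI => /set1gP e; rewrite /commute.
      by rewrite -[LHS](mulgKV q) -[X in (X * q)%g](mulgKV y) e mul1g.
    split; first by rewrite mem_mulg.
    rewrite invMg !mulgA -(mulgA h q y) (cent1P cq) !mulgA mulgK.
    by rewrite !groupM ?groupV ?cycle_id.
  rewrite TI_cardMg //.
  by apply/trivgP; rewrite -tI setIS ?subsetIl.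
move=> g Cg; case: ifP => // _ /=.
rewrite -!inflationE -[inflation A _]/(res_lattice sCN (inflation A) _).
exact: (mxtrace_conj (res_lattice sCN (inflation A)) Cy Cg).
Qed.

End ProjectiveCoverTrace.

(** * Euler characteristics of posets of p-subgroups *)

Section Chains.

Variables (I : finType) (le : rel I).
Implicit Types (T s : {set I}).

Definition chains T : {set {set I}} :=
  [set s : {set I} | (s \subset T) &&
     [forall a in s, forall b in s, le a b || le b a]].

(** The empty chain counts, so this is minus the reduced Euler characteristic of the order complex
    of T. *)
Definition euler T : int := \sum_(s in chains T) (-1) ^+ #|s|.

Definition below T t := [set x in T | le x t && (x != t)].

Lemma chainsP T s :
  reflect ({subset s <= T} /\ {in s &, forall a b, le a b || le b a})
          (s \in chains T).
Proof.
rewrite inE; apply: (iffP andP) => [[/subsetP sT /forall_inP c]|[sT c]].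
  by split=> // a b sa sb; have /forall_inP := c a sa; apply.
split; first exact/subsetP.
by apply/forall_inP=> a sa; apply/forall_inP=> b sb; apply: c.
Qed.

Hypotheses (leR : reflexive le) (leA : antisymmetric le) (leT : transitive le).

Lemma chain_max T s : s \in chains T -> s != set0 ->
  exists2 t, t \in s & forall x, x \in s -> le x t.
Proof.
case/chainsP=> _; have [n] := ubnP #|s|; elim: n s => // n IHn s /ltnSE-len cs.
case/set0Pn=> a sa; have [s0|[b sb]] := set_0Vmem (s :\ a).
  exists a => // x sx; have [->|nxa] := eqVneq x a; first exact: leR.
  by have := in_set0 x; rewrite -s0 !inE nxa sx.
have [|||t st tmax] := IHn (s :\ a).
- by apply: leq_trans len; rewrite [X in (_ < X)%N](cardsD1 a) sa ltnS.
- by move=> x z; rewrite !inE => /andP[_ sx] /andP[_ sz]; apply: cs.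
- by apply/set0Pn; exists b.
move: st; rewrite !inE => /andP[_ st].
have [lat|lta] : le a t \/ le t a by apply/orP; apply: cs.
  exists t => // x sx; have [->//|nxa] := eqVneq x a.
  by apply: tmax; rewrite !inE nxa.
exists a => // x sx; have [->//|nxa] := eqVneq x a.
by apply: leT lta; apply: tmax; rewrite !inE nxa.
Qed.

(** Nonempty chains are sorted by their largest member; deleting it changes the sign. *)
Lemma euler_top T : euler T = 1 - \sum_(t in T) euler (below T t).
Proof.
have c0 : set0 \in chains T by apply/chainsP; split=> [x|x y]; rewrite inE.
rewrite /euler (bigD1 set0) //= cards0 expr0; congr (_ + _).
rewrite -sumrN.
rewrite (eq_bigr (fun s => \sum_(t in T)
    if (t \in s) && [forall x in s, le x t] then (-1) ^+ #|s| else 0)); last first.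
  move=> s /andP[cs s0]; have [t st tmax] := chain_max cs s0.
  have [sT _] := chainsP _ _ cs.
  rewrite (bigD1 t) ?sT //= st /= ifT; last by apply/forall_inP.
  rewrite big1 ?addr0 // => u /andP[_ nut]; case: ifP => // /andP[su /forall_inP umax].
  by case/eqP: nut; apply: leA; rewrite umax // tmax.
rewrite exchange_big; apply: eq_bigr => t Tt; rewrite -big_mkcondr /=.
rewrite (reindex_onto (fun s => t |: s) (fun s => s :\ t)) /=; last first.
  by move=> s /and3P[_ st _]; rewrite setD1K.
rewrite -sumrN; apply: eq_big => s.
  apply/idP/chainsP.
    case/andP=> /andP[/andP[/chainsP[sT sc] _] /andP[_ /forall_inP tmax]] /eqP es.
    have nts : t \notin s by rewrite -es !inE eqxx.
    split=> [x sx|a b sa sb]; last by apply: sc; rewrite !inE ?sa ?sb orbT.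
    rewrite inE sT ?inE ?sx ?orbT // tmax ?inE ?sx ?orbT //=.
    by apply: contraNneq nts => <-.
  case=> sT sc; have nts : t \notin s.
    by apply/negP=> /sT; rewrite !inE eqxx !andbF.
  rewrite setU1K // eqxx andbT setU11 /= -andbA; apply/and3P; split.
  - apply/chainsP; split=> [x|a b].
      by case/setU1P=> [->//|/sT]; rewrite inE => /andP[].
    case/setU1P=> [->|sa]; case/setU1P=> [->|sb]; rewrite ?leR //.
    + by have := sT b sb; rewrite inE => /and3P[_ -> _]; rewrite orbT.
    + by have := sT a sa; rewrite inE => /and3P[_ -> _].
    exact: sc.
  - by apply/set0Pn; exists t; rewrite setU11.
  apply/forall_inP=> x /setU1P[->//|/sT]; by rewrite inE => /and3P[].
case/andP=> _ /eqP es.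
have nts : t \notin s by rewrite -es !inE eqxx.
by rewrite cardsU1 nts exprS mulN1r.
Qed.

Lemma below_below T t u : t \in T -> u \in below T t -> below (below T t) u = below T u.
Proof.
move=> Tt; rewrite inE => /and3P[Tu lut nut].
apply/setP=> x; rewrite !inE; apply/idP/idP=> [/andP[/andP[-> _]]//|].
case/and3P=> Tx lxu nxu; rewrite Tx lxu nxu (leT lxu lut) /= andbT.
by apply: contraNneq nxu => ext; apply/eqP/leA; rewrite lxu ext lut.
Qed.

(* [x >= phi x <= c] is Quillen's conical contraction of T onto c. *)
Lemma euler_cone T c (phi : I -> I) : c \in T ->
    (forall x, x \in T -> [/\ phi x \in T, le (phi x) x & le (phi x) c]) ->
    {in T &, forall x y, le x y -> le (phi x) (phi y)} ->
  euler T = 0.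
Proof.
have [n] := ubnP #|T|; elim: n T c => // n IHn T c /ltnSE-len Tc phiP phi_mono.
(* The part below such a t is again conical, onto phi t. So only t <= c contribute to [euler_top],
   and the term of c cancels 1 and the terms of all t < c. *)
have belowN t : t \in T -> ~~ le t c -> euler (below T t) = 0.
  move=> Tt ntc; have [Tpt lpt lptc] := phiP t Tt.
  have sub x : x \in below T t -> x \in T by rewrite inE => /andP[].
  apply: (IHn _ (phi t)).
  - apply: leq_trans len; rewrite [X in (_ < X)%N](cardsD1 t) Tt ltnS.
    by apply/subset_leq_card/subsetP=> x; rewrite !inE => /and3P[-> _ ->].
  - by rewrite inE Tpt lpt /=; apply: contraNneq ntc => <-.
  - move=> x xt; have [Tpx lpx lpxc] := phiP x (sub x xt).
    move: (xt); rewrite inE => /and3P[Tx lxt nxt]; split=> //; last exact: phi_mono.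
    rewrite inE Tpx (leT lpx lxt) /=; apply: contraNneq nxt => e.
    by apply/eqP/leA; rewrite lxt -{1}e lpx.
  by move=> x z /sub Tx /sub Tz; apply: phi_mono.
rewrite euler_top (bigID (fun t => le t c)) /=.
rewrite [X in _ - (_ + X)]big1 ?addr0; last first.
  by move=> t /andP[]; apply: belowN.
rewrite (bigD1 c) /=; last by rewrite Tc leR.
rewrite [X in _ - (X + _)]euler_top.
rewrite (eq_bigl (mem (below T c))) => [|t]; last by rewrite !inE andbA.
rewrite [X in _ - (_ - X + _)](eq_bigr (fun t => euler (below T t))).
  by rewrite subrK subrr.
by move=> u uc; rewrite below_below.
Qed.

End Chains.

Lemma chains_dual (I : finType) (le : rel I) T :
  chains (fun x y => le y x) T = chains le T.
Proof.
by apply/setP=> s; apply/chainsP/chainsP=> -[sT c]; split=> // a b sa sb;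
  rewrite orbC; apply: c.
Qed.

Lemma euler_dual (I : finType) (le : rel I) T :
  euler (fun x y => le y x) T = euler le T.
Proof. by rewrite /euler chains_dual. Qed.

Lemma euler_imset (I J : finType) (leI : rel I) (leJ : rel J) (h : I -> J)
    (T : {set I}) : {in T &, injective h} ->
    {in T &, forall x y, leJ (h x) (h y) = leI x y} ->
  euler leJ (h @: T) = euler leI T.
Proof.
move=> injh hle; rewrite /euler.
have sub s : s \in chains leI T -> {subset s <= T} by case/chainsP.
have -> : chains leJ (h @: T) = [set h @: s | s : {set I} in chains leI T].
  apply/setP=> s; apply/chainsP/imsetP.
    case=> sT c; exists [set x in T | h x \in s].
      apply/chainsP; split=> [x|a b]; first by rewrite inE => /andP[].
      rewrite !inE => /andP[Ta sa] /andP[Tb sb]; rewrite -!hle //; exact: c.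
    apply/setP=> y; apply/idP/imsetP=> [sy|[x]].
      by have /imsetP[x Tx e] := sT y sy; exists x; rewrite // inE Tx -e.
    by rewrite inE => /andP[_ sx ->].
  case=> u /chainsP[uT uc] ->; split=> [y /imsetP[x ux ->]|].
    by apply: imset_f; apply: uT.
  move=> _ _ /imsetP[a ua ->] /imsetP[b ub ->]; rewrite !hle ?uT //.
  exact: uc.
rewrite big_imset /=.
  apply: eq_bigr => s /sub sT; congr (_ ^+ _); rewrite card_in_imset //.
  by move=> x y sx sy; apply: injh; apply: sT.
move=> s u /sub sT /sub uT e; apply/setP=> x; apply/idP/idP=> xin.
  have : h x \in h @: u by rewrite -e imset_f.
  by case/imsetP=> z uz e'; rewrite (injh _ _ (sT x xin) (uT z uz) e').
have : h x \in h @: s by rewrite e imset_f.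
by case/imsetP=> z uz e'; rewrite (injh _ _ (uT x xin) (sT z uz) e').
Qed.

Definition sub_rel (gT : finGroupType) : rel {group gT} := fun P Q => P \subset Q.
Arguments sub_rel : clear implicits.

Lemma sub_rel_anti (gT : finGroupType) : antisymmetric (sub_rel gT).
Proof. by move=> P Q e; apply/group_inj/eqP; rewrite eqEsubset. Qed.

Lemma sub_rel_trans (gT : finGroupType) : transitive (sub_rel gT).
Proof. by move=> Q P L; apply: subset_trans. Qed.

Section PSubgroupPoset.

Variables (p : nat) (gT : finGroupType) (G : {group gT}) (y : gT).
Implicit Types P Q : {group gT}.

Definition fixed_psubgroups : {set {group gT}} :=
  [set Q : {group gT} | [&& Q \subset G, p.-group Q & y \in 'N(Q)]].

Definition above Q := [set P in fixed_psubgroups | Q \proper P].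

Definition above_norm Q := [set P in above Q | P \subset 'N(Q)].

Lemma in_fixed Q : (Q \in fixed_psubgroups) =
  [&& Q \subset G, p.-group Q & y \in 'N(Q)].
Proof. by rewrite [LHS]inE. Qed.

Lemma in_above P Q : (P \in above Q) = (P \in fixed_psubgroups) && (Q \proper P).
Proof. by rewrite inE. Qed.

Local Notation le := (sub_rel gT).

Let leR : reflexive le. Proof. by move=> P; apply: subxx. Qed.
Let leA := @sub_rel_anti gT.
Let leT := @sub_rel_trans gT.

(** [euler_top] for the opposite order: chains are sorted by their smallest member. *)
Lemma euler_above Q : euler le (above Q) = 1 - \sum_(P in above Q) euler le (above P).
Proof.
rewrite -euler_dual (@euler_top _ (fun P L => le L P)) //.
- congr (_ - _); apply: eq_bigr => P PQ; rewrite -[RHS]euler_dual.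
  move: PQ; rewrite inE => /andP[_ ltQP].
  congr (euler _ _); apply/setP=> L; rewrite [LHS]inE !in_above.
  case: (L \in fixed_psubgroups) => //=.
  apply/andP/idP=> [[_ /andP[lPL nLP]]|ltPL].
    rewrite properEneq (lPL : P \subset L) andbT eq_sym.
    by apply: contra nLP => /eqP/group_inj->.
  split; first exact: proper_trans ltPL.
  rewrite [le P L](proper_sub ltPL) /=.
  by apply: contraTneq ltPL => ->; rewrite properxx.
- by move=> P L /andP[? ?]; apply: leA; rewrite /sub_rel; apply/andP.
- by move=> P L M ? ?; apply: (@leT P).
Qed.

Lemma sum_euler_above Q : Q \in fixed_psubgroups ->
  \sum_(P in fixed_psubgroups | Q \subset P) euler le (above P) = 1.
Proof.
move=> FQ; rewrite (bigD1 Q) /=; last by rewrite FQ subxx.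
rewrite euler_above [X in _ + X](eq_bigl (mem (above Q))) ?subrK // => P.
by rewrite [RHS]inE properEneq -andbA andbC [X in _ = _ && X]andbC eq_sym andbC.
Qed.

Lemma fixed_norm P Q : P \in fixed_psubgroups -> Q \in fixed_psubgroups ->
  'N_P(Q)%G \in fixed_psubgroups.
Proof.
rewrite !in_fixed => /and3P[sPG pP yP] /and3P[_ _ yQ].
have sPQ : 'N_P(Q) \subset P := subsetIl _ _.
rewrite (subset_trans sPQ sPG) (pgroupS sPQ pP) /=.
by rewrite -cycle_subG normsI ?norms_norm ?cycle_subG.
Qed.

(** For P not normalising Q, the poset strictly between Q and P contracts by L >= N_L(Q) <= N_P(Q),
    since normalisers grow in p-groups; so P adds nothing to [euler_top]. *)
Lemma euler_above_norm Q : Q \in fixed_psubgroups ->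
  euler le (above Q) = euler le (above_norm Q).
Proof.
move=> FQ; rewrite !(euler_top leR leA leT); congr (_ - _).
rewrite (bigID (fun P : {group gT} => P \subset 'N(Q))) /=.
rewrite [X in _ + X]big1 ?addr0.
  apply: eq_big => P; first by rewrite [RHS]inE.
  case/andP=> QP sPN; congr (euler _ _); apply/setP=> L; rewrite !inE.
  apply/idP/idP=> [/andP[-> /andP[sLP ->]]|/andP[/andP[-> _] ->]] //.
  by rewrite (subset_trans sLP) //= andbT.
move=> P /andP[QP nPN]; have := QP; rewrite inE => /andP[FP ltQP].
have pP : p.-group P by move: FP; rewrite in_fixed => /and3P[].
have normT (L : {group gT}) : Q \proper L -> L \in fixed_psubgroups -> L \subset P ->
    'N_L(Q)%G \in below le (above Q) P.
  move=> ltQL FL sLP; have pL := pgroupS sLP pP.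
  rewrite /below in_set in_above fixed_norm //=.
  rewrite (nilpotent_proper_norm (pgroup_nil pL)) //=.
  have -> /= : le 'N_L(Q)%G P by apply: subset_trans sLP; apply: subsetIl.
  by apply: contra nPN => /eqP <-; apply: subsetIr.
apply: (@euler_cone _ le leR leA leT _ ('N_P(Q)%G) (fun L => 'N_L(Q)%G)).
- exact: normT.
- move=> L; rewrite inE in_above => /and3P[/andP[FL ltQL] sLP _]; split.
  + exact: normT.
  + exact: subsetIl.
  + exact: setSI.
by move=> L M _ _; apply: setSI.
Qed.

End PSubgroupPoset.

Section RadicalSum.

Variables (p : nat) (gT : finGroupType) (G : {group gT}).
Implicit Types (P Q : {group gT}) (y : gT).

Local Notation le := (sub_rel gT).

Lemma in_above_norm y Q P : (P \in above_norm p G y Q) =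
  [&& P \in fixed_psubgroups p G y, Q \proper P & P \subset 'N(Q)].
Proof. by rewrite in_set in_above andbA. Qed.

(** With M = O_p(N_G(Q)) strictly larger than Q, the poset contracts by L <= L M >= M. *)
Lemma euler_above_norm0 y Q : y \in G -> Q \in fixed_psubgroups p G y ->
  Q != 'O_p('N_G(Q))%G -> euler le (above_norm p G y Q) = 0.
Proof.
move=> Gy; rewrite in_fixed => /and3P[sQG pQ yQ] nQM.
set M := ('O_p('N_G(Q)))%G in nQM *.
have sMN : M \subset 'N_G(Q) := pcore_sub _ _.
have nMN : 'N_G(Q) \subset 'N(M) := gFnorm _ _.
have Ny : y \in 'N_G(Q) by rewrite inE Gy.
have sQM : Q \subset M.
  by rewrite pcore_max // /normal subsetI sQG normG subsetIr.
have ltQM : Q \proper M.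
  by rewrite properEneq sQM andbT; apply: contra nQM => /eqP e; apply/eqP/group_inj.
rewrite -euler_dual.
apply: (@euler_cone _ (fun L P => le P L) _ _ _ _ M (fun L => L <*> M)%G).
- by move=> P; apply: subxx.
- by move=> P L e; apply: sub_rel_anti; rewrite andbC.
- by move=> P L K e1 e2; apply: sub_rel_trans e1.
- rewrite in_above_norm ltQM (subset_trans sMN (subsetIr _ _)) andbT andbT.
  by rewrite in_fixed (subset_trans sMN (subsetIl _ _)) pcore_pgroup (subsetP nMN).
- move=> L; rewrite in_above_norm in_fixed.
  case/and3P=> /and3P[sLG pL yL] ltQL sLN.
  have sLN' : L \subset 'N_G(Q) by rewrite subsetI sLG.
  split; [|exact: joing_subl|exact: joing_subr].
  rewrite in_above_norm in_fixed join_subG sLG (subset_trans sMN (subsetIl _ _)) /=.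
  rewrite join_subG sLN (subset_trans sMN (subsetIr _ _)) !andbT.
  rewrite (proper_sub_trans ltQL (joing_subl _ _)) andbT.
  apply/andP; split.
    by rewrite /= norm_joinEl ?(subset_trans sLN') // pgroupM pL pcore_pgroup.
  by rewrite -cycle_subG normsY // ?cycle_subG // (subsetP nMN).
by move=> L K _ _ sLK; apply: genS; apply: setSU.
Qed.

(** Each p-element x of C_G(y) is counted as the sum of the Euler numbers of the y-stable
    p-subgroups containing x. After exchanging sums, Q occurs once for each element of C_Q(y). *)
Lemma Psi1_euler y : y \in G -> p^'.-elt y ->
  (Psi1 p G y)%:Z =
  \sum_(Q in radical_subgroups p G | y \in 'N(Q))
     #|'C_Q[y]|%:Z * euler le (above_norm p G y Q).
Proof.
move=> Gy py; rewrite /Psi1 py.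
rewrite (eq_bigl (fun Q => (Q \in fixed_psubgroups p G y) && (Q == 'O_p('N_G(Q))%G))).
  rewrite big_mkcondr (eq_bigr (fun Q => #|'C_Q[y]|%:Z * euler le (above p G y Q))).
    set S := [set x in _ | _].
    rewrite (eq_bigr (fun Q => \sum_(x in S)
        if x \in Q then euler le (above p G y Q) else 0)).
      rewrite exchange_big (eq_bigr (fun=> 1)) => [|x].
        by rewrite sumr_const natz.
      rewrite inE => /andP[/setIP[Gx cyx] px]; rewrite -big_mkcondr.
      rewrite (eq_bigl (fun Q =>
          (Q \in fixed_psubgroups p G y) && (<[x]>%G \subset Q))).
        apply: sum_euler_above; rewrite in_fixed cycle_subG Gx [p.-group _]px /=.
        by rewrite (subsetP (cent_sub _)) // cent_cycle cent1C.
      by move=> Q; rewrite cycle_subG.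
    move=> Q; rewrite in_fixed => /and3P[sQG pQ yQ].
    rewrite -big_mkcondr sumr_const -mulr_natl; congr (_ * _).
    rewrite -natz; congr (_%:R); apply: eq_card => x.
    rewrite -[RHS]/((x \in S) && (x \in Q)) /S [x \in [set _ in _ | _]]in_set !in_setI.
    case Qx: (x \in Q); last by rewrite andbF.
    by rewrite (subsetP sQG) // (mem_p_elt pQ) //= !andbT.
  move=> Q FQ; rewrite euler_above_norm //; case: ifP => [//|/negbT nQ].
  by rewrite euler_above_norm0 ?mulr0.
move=> Q; rewrite in_fixed [Q \in _]inE.
case: (Q \subset G) => //=; case: (p.-group Q) => //=.
by rewrite andbC.
Qed.

Lemma above_norm_conj y Q g : g \in G ->
  euler le (above_norm p G y (Q :^ g)%G) =
  euler le (above_norm p G (g * y * g^-1)%g Q).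
Proof.
move=> Gg; have memJ P : ((P :^ g)%G \in above_norm p G y (Q :^ g)%G) =
    (P \in above_norm p G (g * y * g^-1)%g Q).
  rewrite !in_above_norm !in_fixed /= pgroupJ properJ !normJ conjSg.
  by rewrite -{1}(conjGid Gg) conjSg mem_conjg conjgE invgK mulgA.
have -> : above_norm p G y (Q :^ g)%G =
    [set (P :^ g)%G | P : {group gT} in above_norm p G (g * y * g^-1)%g Q].
  apply/setP=> P; apply/idP/imsetP=> [Pin | [L Lin ->]]; last by rewrite memJ.
  have eP : P = ((P :^ g^-1) :^ g)%G by apply/group_inj; rewrite /= conjsgKV.
  by exists (P :^ g^-1)%G; rewrite -?memJ -?eP.
apply: euler_imset => [P L _ _ e|P L _ _]; last by rewrite /sub_rel conjSg.
by apply: group_inj; apply: (@conjsg_inj _ g); have := congr1 (@gval _) e.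
Qed.

End RadicalSum.

(** A member of a stable chain and its conjugate by x are comparable and of equal order, hence
    equal. *)
Lemma fixed_chains (p : nat) (gT : finGroupType) (X : {group gT}) x : x \in X ->
  [set s in p_chains p X | x \in 'N(s | 'JG)] =
  chains (sub_rel gT)
    [set P : {group gT} | [&& P \subset X, p.-group P, P :!=: 1%g & x \in 'N(P)]].
Proof.
move=> Xx; apply/setP=> s; rewrite inE; apply/andP/chainsP.
  case; rewrite inE => /andP[/forall_inP sP /forall_inP cP] /astabsP fix_s.
  have cs : {in s &, forall P L : {group gT}, (P \subset L) || (L \subset P)}.
    by move=> P L sP' sL; have /forall_inP := cP P sP'; apply.
  split=> // P Ps; have /and3P[sPX pP ntP] := sP P Ps.
  rewrite in_set sPX pP ntP /=.
  have Pxs : (P :^ x)%G \in s by have /= := fix_s P; rewrite Ps.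
  have [sPx|sxP] := orP (cs _ _ Ps Pxs).
    apply/normP; apply/esym/eqP; rewrite eqEcard sPx cardJg leqnn //.
  by apply/normP; apply/eqP; rewrite eqEcard sxP cardJg leqnn.
case=> sT cs; split.
  rewrite inE; apply/andP; split.
    by apply/forall_inP=> P /sT; rewrite [_ \in _]inE => /and4P[-> -> -> _].
  by apply/forall_inP=> P sP; apply/forall_inP=> L sL; apply: cs.
rewrite !inE /=; apply/subsetP=> P sP; rewrite inE /=.
have : P \in [set P : {group gT} |
    [&& P \subset X, p.-group P, P :!=: 1%g & x \in 'N(P)]].
  exact: sT.
rewrite inE => /and4P[_ _ _ xP].
suff -> : (P :^ x)%G = P by [].
by apply: group_inj; apply/normP.
Qed.

(** Preimages under the quotient map match nontrivial p-subgroups of N_G(Q)/Q with the p-subgroups P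
    such that Q < P <= N_G(Q). *)
Lemma euler_quotient (p : nat) (gT : finGroupType) (G Q : {group gT}) y :
    Q \subset G -> p.-group Q -> y \in 'N_G(Q) ->
  \sum_(s in p_chains p ('N_G(Q) / Q) | coset Q y \in 'N(s | 'JG)) (-1) ^+ #|s| =
  euler (sub_rel gT) (above_norm p G y Q).
Proof.
move=> sQG pQ Ny; have Nbar : coset Q y \in ('N_G(Q) / Q)%G by apply: mem_quotient.
have sNN : 'N_G(Q) \subset 'N(Q) := subsetIr _ _.
have nQN : Q <| 'N_G(Q) by rewrite normalSG.
pose T := [set P : {group coset_of Q} | [&& P \subset ('N_G(Q) / Q)%G,
  p.-group P, P :!=: 1%g & coset Q y \in 'N(P)]].
pose h (K : {group coset_of Q}) := (coset Q @*^-1 K)%G.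
have inT (K : {group coset_of Q}) : (K \in T) = [&& K \subset ('N_G(Q) / Q)%G,
  p.-group K, K :!=: 1%g & coset Q y \in 'N(K)] by rewrite [LHS]inE.
rewrite (eq_bigl (mem (chains (sub_rel _) T))) => [|s]; last first.
  by rewrite -(fixed_chains p Nbar) [RHS]inE.
rewrite -/(euler _ T); have -> : above_norm p G y Q = h @: T.
  apply/setP=> P; apply/idP/imsetP.
    rewrite in_above_norm in_fixed => /and3P[/and3P[sPG pP yP] ltQP sPN].
    have sPNG : P \subset 'N_G(Q) by rewrite subsetI sPG.
    exists (P / Q)%G; last first.
      by apply/group_inj; rewrite /= quotientGK // /normal (proper_sub ltQP).
    rewrite inT quotientS // quotient_pgroup //= -subG1 quotient_sub1 //.
    rewrite (proper_subn ltQP) /=.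
    apply: (subsetP (quotient_norms Q (_ : <[y]> \subset _))).
      by rewrite cycle_subG.
    apply: mem_quotient; exact: cycle_id.
  case=> K; rewrite inT => /and4P[sKN pK ntK yK] ->.
  rewrite in_above_norm in_fixed /h /=.
  have sKN' : coset Q @*^-1 K \subset 'N_G(Q).
    by rewrite -(quotientGK nQN) cosetpreSK.
  rewrite (subset_trans sKN' (subsetIl _ _)) (subset_trans sKN' sNN) andbT /=.
  rewrite /pgroup card_cosetpre pnatM [p.-nat #|Q|]pQ [p.-nat #|K|]pK /=.
  apply/andP; split.
    apply: (subsetP (morphpre_norm _ _)).
    by rewrite mem_morphpre // (subsetP sNN).
  rewrite properE sub_cosetpre /=; apply: contra ntK => sKQ.
  by rewrite -subG1 -cosetpreSK cosetpre1.
apply/esym/euler_imset => [K L _ _ e|K L _ _]; last exact: cosetpreSK.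
have eKL : coset Q @*^-1 K = coset Q @*^-1 L := congr1 (@gval _) e.
by apply: group_inj; rewrite -(cosetpreK K) eKL cosetpreK.
Qed.

(** * Traces of virtual lattices *)

Lemma transversal_sum (aT : finGroupType) (T : finType)
    (to : {action aT &-> T}) (G : {group aT}) (S X : {set T})
    (V : nmodType) (f : T -> V) :
    [acts G, on S | to] -> is_transversal X (orbit to G @: S) S ->
  \sum_(x in S) f x = \sum_(x in X) \sum_(z in orbit to G x) f z.
Proof.
move=> actsG trX; have partS := orbit_partition actsG.
rewrite (set_partition_big _ partS) -[in LHS](pblock_transversal trX).
rewrite big_imset /=; last exact: pblock_inj trX.
have /and3P[_ tiP _] := partS.
apply: eq_bigr => x Xx; rewrite (def_pblock tiP _ (orbit_refl to G x)) //.
by apply: imset_f; apply: (subsetP (transversal_sub trX)).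
Qed.

Section VirtualTrace.

Variables (R : idomainType).
Hypothesis natR_inj : injective (fun n : nat => n%:R : R).

Definition vtrace (gT : finGroupType) (G : {group gT}) (V : virtual R G) x :=
  \tr (V.1 x) - \tr (V.2 x).

Lemma mxtrace_zero (gT : finGroupType) (G : {group gT}) x :
  \tr (@zero_lattice R gT G x) = 0.
Proof. by rewrite /mxtrace big_ord0. Qed.

Lemma vtrace_sum (gT : finGroupType) (G : {group gT}) (I : finType) (A : {set I})
    (V : I -> virtual R G) x :
  vtrace (\big[@green_add R gT G/green_zero]_(i in A) V i) x =
  \sum_(i in A) vtrace (V i) x.
Proof.
apply: (big_morph (fun W : virtual R G => vtrace W x)).
  by move=> W1 W2; rewrite /vtrace !mxtrace_block addrACA opprD.
by rewrite /vtrace !mxtrace_zero subrr.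
Qed.

Lemma vtrace_sign (gT : finGroupType) (G : {group gT}) n (V : virtual R G) x :
  vtrace (green_sign n V) x = (-1) ^+ n * vtrace V x.
Proof.
rewrite /green_sign -signr_odd /vtrace; case: (odd n); last by rewrite mul1r.
by rewrite mulN1r opprB.
Qed.

Lemma vtrace_class (gT : finGroupType) (G : {group gT}) (M : lattice R G) x :
  vtrace (green_class M) x = \tr (M x).
Proof. by rewrite /vtrace mxtrace_zero subr0. Qed.

(** Frobenius' formula for induction from a stabiliser: the cosets of H are the points of the orbit
    of t. It serves both for chains and for conjugates of Q. *)
Lemma vtrace_induced_orbit (gT : finGroupType) (G H : {group gT}) (T : finType)
    (to : {action gT &-> T}) t (V : virtual R H) (f : T -> R) y :
    H = 'C_G[t | to] :> {set gT} ->
    (forall g, g \in G -> f (to t g) =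
       if (g * y * g^-1)%g \in H then vtrace V (g * y * g^-1)%g else 0) ->
  vtrace (green_ind G V) y = \sum_(u in orbit to G t) f u.
Proof.
move=> eH ef; have sHG : H \subset G by rewrite eH subsetIl.
have natH : #|H|%:R != 0 :> R.
  apply/eqP=> /(@natR_inj _ 0%N) H0; have := cardG_gt0 H; by rewrite H0.
apply: (mulIf natH); rewrite !mulr_natr mulrnBl !(mxtrace_induced_sum sHG).
rewrite -sumrB (eq_bigr (fun g => f (to t g))) => [|g Gg]; last first.
  by rewrite ef //; case: ifP => // _; rewrite subr0.
rewrite (partition_big (to t) (mem (orbit to G t))) => [|g Gg]; last exact: mem_orbit.
rewrite -sumrMnl; apply: eq_bigr => u /orbitP[a Ga <-].
rewrite (eq_bigr (fun=> f (to t a))) => [|g /andP[_ /eqP->]//].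
rewrite sumr_const; congr (_ *+ _).
rewrite -(card_rcoset H a) eH -(amove_act to t (subsetT G) Ga).
by apply: eq_card => g; rewrite !inE.
Qed.

Lemma chain_stabilizerE (gT : finGroupType) (X : {group gT}) s :
  chain_stabilizer X s = 'C_X[s | 'JG^*] :> {set gT}.
Proof. by rewrite astab1_set. Qed.

Lemma acts_p_chains p (gT : finGroupType) (X : {group gT}) :
  [acts X, on p_chains p X | 'JG^*].
Proof.
apply/actsP=> x Xx s.
have sub (t : {set {group gT}}) z : z \in X -> t \in p_chains p X ->
    ('JG^* t z)%act \in p_chains p X.
  move=> Xz; rewrite !inE => /andP[/forall_inP tP /forall_inP tc].
  apply/andP; split.
    apply/forall_inP=> _ /imsetP[P tQ ->] /=.
    have /and3P[sPX pP ntP] := tP P tQ.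
    by rewrite -{1}(conjGid Xz) conjSg sPX pgroupJ pP conjsg_eq1.
  apply/forall_inP=> _ /imsetP[P tQ ->]; apply/forall_inP=> _ /imsetP[L tL ->] /=.
  by rewrite !conjSg; have /forall_inP := tc P tQ; apply.
apply/idP/idP=> [|]; last exact: sub.
by move/(sub _ x^-1%g (groupVr Xx)); rewrite actK.
Qed.

(** Each induced trivial module is the permutation module on an orbit of chains, whose trace counts
    fixed chains. *)
Lemma vtrace_steinberg p (gT : finGroupType) (X : {group gT}) x : x \in X ->
  vtrace (steinberg R p X) x =
  \sum_(s in p_chains p X | x \in 'N(s | 'JG)) (-1) ^+ #|s|.
Proof.
move=> Xx; rewrite vtrace_sum big_mkcondr.
have [trX _ _ _] := orbit_transversalP (acts_p_chains p X).
rewrite (transversal_sum _ (acts_p_chains p X) trX).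
apply: eq_bigr => s _; rewrite vtrace_sign.
set H := chain_stabilizer X s.
transitivity ((-1) ^+ #|s| * \sum_(u in orbit 'JG^* X s)
    (if x \in 'N(u | 'JG) then 1 else 0 : R)).
  congr (_ * _).
  have -> : vtrace (green_class (induced_lattice X (trivial_lattice R H))) x =
            vtrace (green_ind X (green_class (trivial_lattice R H))) x.
    have z : \tr (induced_lattice X (@zero_lattice R gT H) x) = 0.
      rewrite mxtrace_induced big1 // => i _.
      by case: ifP => _; rewrite ?mxtrace_zero.
    by rewrite vtrace_class -[RHS]/(\tr (induced_lattice X (trivial_lattice R H) x) -
      \tr (induced_lattice X (@zero_lattice R gT H) x)) z subr0.
  apply: (vtrace_induced_orbit (chain_stabilizerE X s)) => g Xg.
  have -> : (g * x * g^-1)%g \in H = (x \in 'N(('JG^* s g)%act | 'JG)).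
    rewrite chain_stabilizerE -astab1_set astab1_act mem_conjg conjgE invgK mulgA.
    have Xz : (g * x * g^-1)%g \in X by rewrite !(groupM, groupV).
    by rewrite in_setI Xz.
  by case: ifP => // _; rewrite vtrace_class mxtrace1.
rewrite mulr_sumr; apply: eq_bigr => _ /orbitP[g Xg <-].
by rewrite card_setact; case: ifP; rewrite ?mulr1 ?mulr0.
Qed.

End VirtualTrace.

(** * Virtual projective lattices under sums and induction *)

Section VirtualHProjective.

Variables (R : comUnitRingType).

Definition virtual_hprojective (gT : finGroupType) (G : {group gT})
    (V : virtual R G) :=
  exists A B : lattice R G,
    [/\ hprojective A, hprojective B & green_eq V (A, B)].

Lemma virtual_hprojective_sum (gT : finGroupType) (G : {group gT})
    (I : finType) (A : {set I}) (V : I -> virtual R G) :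
    (forall i, i \in A -> virtual_hprojective (V i)) ->
  virtual_hprojective (\big[@green_add R gT G/green_zero]_(i in A) V i).
Proof.
move=> hV; apply: (big_ind (@virtual_hprojective gT G)) => //.
  exists zero_lattice, zero_lattice; split; try exact: hprojective_zero.
  exact: green_eq_refl.
move=> V1 V2 [A1 [B1 [hA1 hB1 e1]]] [A2 [B2 [hA2 hB2 e2]]].
exists (dsum_lattice A1 A2), (dsum_lattice B1 B2).
split; try exact: hprojective_dsum.
exact: green_add_proper e1 e2.
Qed.

Lemma virtual_hprojective_ind (gT : finGroupType) (H G : {group gT})
    (V : virtual R H) : H \subset G ->
  virtual_hprojective V -> virtual_hprojective (green_ind G V).
Proof.
move=> sHG [A [B [hA hB e]]].
exists (induced_lattice G A), (induced_lattice G B).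
split; try exact: hprojective_induced.
exact: (green_ind_proper G e).
Qed.

End VirtualHProjective.

Section RadicalAction.

Variables (p : nat) (gT : finGroupType) (G : {group gT}).

Lemma acts_radical_subgroups : [acts G, on radical_subgroups p G | 'JG].
Proof.
have sub (Q : {group gT}) z : z \in G -> Q \in radical_subgroups p G ->
    ('JG Q z)%act \in radical_subgroups p G.
  move=> Gz; rewrite !in_set => /and3P[sQG pQ eQ] /=.
  rewrite -{1 2}(conjGid Gz) conjSg sQG pgroupJ pQ normJ -conjIg pcoreJ.
  by rewrite (inj_eq (@conjsg_inj _ z)).
apply/actsP=> x Gx Q; apply/idP/idP=> [|]; last exact: sub.
by move/(sub _ x^-1%g (groupVr Gx)); rewrite actK.
Qed.

Lemma card_subcent1J (Q : {group gT}) y g :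
  #|'C_(Q :^ g)[y]| = #|'C_Q[g * y * g^-1]|.
Proof.
have {1}-> : y = ((g * y * g^-1) ^ g)%g by rewrite conjgE !mulgA mulVg mul1g mulgKV.
by rewrite cent1J -conjIg cardJg.
Qed.

End RadicalAction.

Theorem theorem11p3 (p : nat) (gT : finGroupType) (G : {group gT})
    (K : fieldType) (R : idomainType) (F : fieldType)
    (iota : {rmorphism R -> K}) (red : {rmorphism R -> F})
    (p_prime : prime p)
    (sys : splitting_modular_system p G iota red)
    (reps : {set {group gT}})
    (repsP : is_transversal reps
       (orbit 'JG G @: radical_subgroups p G) (radical_subgroups p G))
    (P1 : virtual R G) (P1P : is_P1 p iota P1)
    (PSt : forall Q : {group gT}, virtual R 'N_G(Q))
    (PStP : forall Q : {group gT}, Q \in reps ->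
       bracket (steinberg R p ('N_G(Q) / Q)) (PSt Q)) :
  green_eq P1
    (\big[@green_add R gT G/green_zero]_(Q in reps) green_ind G (PSt Q)).
Proof.
case: sys => complR iota_inj _ charK red_surj red_ker charF _ splitF.
have natR_inj : injective (fun n : nat => n%:R : R).
  have nat0 n : n%:R = 0 :> R -> n = 0%N.
    move=> /(congr1 iota); rewrite rmorph_nat rmorph0 => /eqP.
    by rewrite ((pcharf0P K).1 charK) => /eqP.
  move=> m n /= e; wlog le_mn : m n e / (m <= n)%N => [hw|].
    by have [/hw|/ltnW/hw] := leqP m n => [->//|<-//].
  apply/eqP; rewrite eqn_leq le_mn -subn_eq0; apply/eqP/nat0.
  by rewrite natrB // e subrr.
have repsR Q : Q \in reps -> [/\ Q \subset G, p.-group Q & Q \in radical_subgroups p G].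
  move/(subsetP (transversal_sub repsP)) => rQ; split=> //;
    by move: rQ; rewrite in_set => /and3P[].
have [[A1 [B1 [pA1 pB1 eP1]]] chiP1] := P1P.
have hS : virtual_hprojective
    (\big[@green_add R gT G/green_zero]_(Q in reps) green_ind G (PSt Q)).
  apply: virtual_hprojective_sum => Q rQ; apply: virtual_hprojective_ind.
    exact: subsetIl.
  have [A [B [PA [PB [_ _ cA cB eV]]]]] := PStP Q rQ.
  by exists PA, PB; split=> //; apply: projective_hprojective;
    [case: cA | case: cB].
have [A2 [B2 [hA2 hB2 eS]]] := hS.
have [hA1 hB1] := (projective_hprojective pA1, projective_hprojective pB1).
apply: (green_eq_trans eP1); apply: (green_eq_trans _ (green_eq_sym eS)).
(* The lattices A1 + B2 and A2 + B1 are themselves isomorphic, so nothing has to be added. *)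
exists zero_lattice; apply: dsum_lattice_proper => //=.
apply: (projective_character_iso red_surj red_ker complR natR_inj charF splitF);
  try exact: hprojective_dsum.
move=> x Gx; rewrite /= !mxtrace_block.
have e1 : \tr (A1 x) - \tr (B1 x) = (Psi1 p G x)%:R.
  rewrite -[LHS](green_eq_trace eP1 Gx); apply: iota_inj.
  by rewrite rmorphB rmorph_nat; apply: chiP1.
suff e2 : \tr (A2 x) - \tr (B2 x) = (Psi1 p G x)%:R.
  by apply/eqP; rewrite -subr_eq addrAC e1 -e2 subrK.
have [px|px] := boolP (p^'.-elt x); last first.
  by rewrite !(hprojective_singular0 red_surj red_ker charF) // subrr /Psi1 (negPf px).
rewrite -[LHS](green_eq_trace eS Gx) -[LHS]/(vtrace _ x) vtrace_sum.
(* The contribution of a single radical subgroup; its sum over the conjugates of Q is the trace of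
   the induced summand at x. *)
pose f (Q : {group gT}) : R := if x \in 'N(Q) then
  (#|'C_Q[x]|%:Z * euler (sub_rel gT) (above_norm p G x Q))%:~R else 0.
rewrite (eq_bigr (fun Q => \sum_(L in orbit 'JG G Q) f L)) => [|Q rQ].
  rewrite -(transversal_sum f (acts_radical_subgroups p G) repsP).
  rewrite -big_mkcondr -rmorph_sum -Psi1_euler //.
have [sQG pQ _] := repsR Q rQ.
apply: vtrace_induced_orbit => //; first by rewrite astab1JG.
move=> g Gg; rewrite /f /= card_subcent1J above_norm_conj // normJ.
rewrite mem_conjg conjgE invgK mulgA.
have Gz : (g * x * g^-1)%g \in G by rewrite !(groupM, groupV).
have pz : p^'.-elt (g * x * g^-1)%g.
  have -> : (g * x * g^-1 = x ^ g^-1)%g by rewrite conjgE invgK mulgA.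
  by rewrite p_eltJ.
rewrite [in RHS]in_setI Gz /=; case: ifP => // Nz.
have NGz : (g * x * g^-1)%g \in 'N_G(Q) by rewrite in_setI Gz.
move: (g * x * g^-1)%g pz NGz {Nz Gz} => z pz NGz.
have [A [B [PA [PB [[pA pB] eSt cA cB eV]]]]] := PStP Q rQ.
rewrite /vtrace (green_eq_trace eV NGz).
rewrite (mxtrace_projective_cover red_ker charF sQG pQ pA cA NGz pz).
rewrite (mxtrace_projective_cover red_ker charF sQG pQ pB cB NGz pz).
have Nbar : coset Q z \in ('N_G(Q) / Q)%G by apply: mem_quotient.
rewrite -mulrnBl -[\tr (A _) - \tr (B _)](green_eq_trace eSt Nbar).
rewrite -[_ - _]/(vtrace _ _) vtrace_steinberg //.
rewrite rmorphM /= -mulr_natl; congr (_ * _).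
rewrite -(euler_quotient sQG pQ NGz) rmorph_sum.
by apply: eq_bigr => s _; rewrite rmorphXn rmorphN rmorph1.
Qed.
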